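(* Let $N\ge1$, $Z_N=Z(\mathrm U(\mathfrak q_N))$, $b_r=c_{2r-1}$ ($r\ge1$) with $c_{2r-1}$ Sergeev's odd cyclic elements, and $\Delta_N=\det(b_{i+j-1})_{1\le i,j\le N}\in Z_N$. Put $x_i=\lambda_i(\lambda_i-1)$, $y_i=\lambda_i(\lambda_i+1)$ for $1\le i\le N$, and $$P_N(z)=\prod_{j=1}^N(1-y_jz),\qquad Q_N(z)=\prod_{i=1}^N(1-x_iz).$$ Then $$\mathrm{HC}(\Delta_N)=(-1)^{\binom N2}\operatorname{Res}(Q_N,P_N)=(-1)^{\binom N2}\prod_{i,j=1}^N(\lambda_i+\lambda_j)\prod_{i\ne j}(\lambda_i-\lambda_j-1),$$ where the last product is over ordered pairs $(i,j)$ with $i\ne j$. In particular, $\Delta_N\ne0$.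
   Context: Ground field $\mathbb C$. Queer Lie superalgebra: fix $N\ge1$, $I_N=\{-N,\dots,-1,1,\dots,N\}$, $\bar i=0$ if $i>0$ and $\bar i=1$ if $i<0$. Let $E_{ij}$ ($i,j\in I_N$) be the matrix units of $\mathfrak{gl}(N|N)$, of parity $\bar i+\bar j$ mod $2$. $\mathfrak q_N\subset\mathfrak{gl}(N|N)$ is the Lie sub-superalgebra spanned by $F_{ij}=E_{ij}+E_{-i,-j}$ (so $F_{-i,-j}=F_{ij}$). $\mathrm U(\mathfrak q_N)$ is its universal enveloping algebra and $Z_N=Z(\mathrm U(\mathfrak q_N))$ its center (in the superalgebra sense; all central elements are even). Harish-Chandra map: $\mathfrak h_{\bar0}=\bigoplus_{i=1}^N\mathbb C F_{ii}$, $\mathfrak h_{\bar 1}=\bigoplus_{i=1}^N\mathbb C F_{i,-i}$, $\mathfrak n_+$ (resp. $\mathfrak n_-$) is the span of $F_{ij},F_{i,-j}$ with $1\le i<j\le N$ (resp. $1\le j<i\le N$). For $z\in Z_N$, $\mathrm{HC}(z)\in\mathbb C[\lambda_1,\dots,\lambda_N]$ is the polynomial with $z\equiv \mathrm{HC}(z)|_{\lambda_i=F_{ii}}$ modulo $\mathfrak n_-\mathrm U(\mathfrak q_N)+\mathrm U(\mathfrak q_N)\mathfrak n_+$ (no $\rho$-shift). It is known that $\mathrm{HC}$ is an algebra isomorphism of $Z_N$ onto $\Gamma_N$, the algebra of symmetric polynomials $f\in\mathbb C[\lambda_1,\dots,\lambda_N]$ such that $f(t,-t,\lambda_3,\dots,\lambda_N)$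 is independent of $t$ (no condition if $N=1$). Cyclic elements: for $r\ge1$, $$c_r=\sum_{i_1,\dots,i_r\in I_N}(-1)^{\bar i_2+\cdots+\bar i_r}F_{i_1i_2}F_{i_2i_3}\cdots F_{i_ri_1}\in \mathrm U(\mathfrak q_N);$$ these are known to be central. Resultant: $P_N,Q_N$ are polynomials in $z$ of degree $N$ over $K=\mathbb C(\lambda_1,\dots,\lambda_N)$. If $f$ has degree $m$, leading coefficient $a_f$ and roots $\alpha_1,\dots,\alpha_m$ with multiplicity, then $\operatorname{Res}(f,g)=a_f^{\deg g}\prod_{k=1}^mg(\alpha_k)$. *)

(* Defs.v *)
(* Everything is defined over an arbitrary field K; the ground field C of the
   statement is R[i] for R : realType. *)
From HB Require Import structures.
From mathcomp Require Export all_boot all_order all_algebra.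
From mathcomp Require Export mpoly complex.
From mathcomp Require Export boolp reals.

Set Implicit Arguments.
Unset Strict Implicit.
Unset Printing Implicit Defensive.

Export GRing.Theory.
#[global] Open Scope ring_scope.

(* The index set I_N = {-N, ..., -1, 1, ..., N} is encoded as 'I_(N + N):
   pos k stands for k + 1 and neg k for -(k + 1). *)
Section Indices.
Variable N : nat.

Definition pos (k : 'I_N) : 'I_(N + N) := lshift N k.
Definition neg (k : 'I_N) : 'I_(N + N) := rshift N k.

Definition opp_idx (i : 'I_(N + N)) : 'I_(N + N) :=
  match split i with inl k => neg k | inr k => pos k end.

Definition par (i : 'I_(N + N)) : bool :=
  match split i with inl _ => false | inr _ => true end.

Lemma opp_pos k : opp_idx (pos k) = neg k.
Proof. by rewrite /opp_idx /pos (unsplitK (inl k)). Qed.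

Lemma opp_neg k : opp_idx (neg k) = pos k.
Proof. by rewrite /opp_idx /neg (unsplitK (inr k)). Qed.

Lemma par_pos k : par (pos k) = false.
Proof. by rewrite /par /pos (unsplitK (inl k)). Qed.

Lemma par_neg k : par (neg k) = true.
Proof. by rewrite /par /neg (unsplitK (inr k)). Qed.

Lemma idxP (P : 'I_(N + N) -> Prop) :
  (forall k, P (pos k)) -> (forall k, P (neg k)) -> forall i, P i.
Proof. by move=> Pp Pn i; case: (splitP i) => k e;
  [have -> : i = pos k by apply: val_inj | have -> : i = neg k by apply: val_inj].
Qed.

Lemma opp_idxK : involutive opp_idx.
Proof. by apply: idxP => k; rewrite ?opp_pos ?opp_neg ?opp_pos. Qed.

End Indices.

Section GL.
Variables (K : fieldType) (N : nat).
Implicit Types X Y : 'M[K]_(N + N).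

(* X is homogeneous of parity p in gl(N|N); 0 is homogeneous of both parities. *)
Definition mx_homog (p : bool) X : Prop :=
  forall i j, X i j != 0 -> par i (+) par j = p.

(* The superbracket of X of parity p and Y of parity q. *)
Definition sbracket (p q : bool) X Y : 'M[K]_(N + N) :=
  X *m Y - (-1) ^+ (p && q) *: (Y *m X).

End GL.

(* The universal enveloping algebra U(g) of a Lie sub-superalgebra g of
   gl(N|N): the unital associative algebra presented by generators Gen x, x in
   g, and the relations that x |-> Gen x is linear and that
   x y - (-1)^(|x||y|) y x = [x, y] for x, y homogeneous.  It is the quotient
   of the formal expressions in the generators by the least congruence that
   contains these relations and the axioms of a unital associative algebra. *)
Section Enveloping.
Local Open Scope quotient_scope.
Variables (K : fieldType) (N : nat) (g : {vspace 'M[K]_(N + N)}).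

Inductive expr : Type :=
| Gen of subvs_of g
| Sca of K
| Add of expr & expr
| Mul of expr & expr.

Inductive cong : expr -> expr -> Prop :=
| cong_refl s : cong s s
| cong_sym s t : cong s t -> cong t s
| cong_trans s t u : cong s t -> cong t u -> cong s u
| cong_add s s' t t' : cong s s' -> cong t t' -> cong (Add s t) (Add s' t')
| cong_mul s s' t t' : cong s s' -> cong t t' -> cong (Mul s t) (Mul s' t')
| cong_addA s t u : cong (Add s (Add t u)) (Add (Add s t) u)
| cong_addC s t : cong (Add s t) (Add t s)
| cong_add0 s : cong (Add (Sca 0) s) s
| cong_addN s : cong (Add (Mul (Sca (-1)) s) s) (Sca 0)
| cong_mulA s t u : cong (Mul s (Mul t u)) (Mul (Mul s t) u)
| cong_mulDl s t u : cong (Mul (Add s t) u) (Add (Mul s u) (Mul t u))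
| cong_mulDr s t u : cong (Mul s (Add t u)) (Add (Mul s t) (Mul s u))
| cong_mul1 s : cong (Mul (Sca 1) s) s
| cong_scaD a b : cong (Sca (a + b)) (Add (Sca a) (Sca b))
| cong_scaM a b : cong (Sca (a * b)) (Mul (Sca a) (Sca b))
| cong_scaC a s : cong (Mul (Sca a) s) (Mul s (Sca a))
| cong_lin a x y :
    cong (Gen (a *: x + y)) (Add (Mul (Sca a) (Gen x)) (Gen y))
| cong_bracket p q x y z :
    mx_homog p (vsval x) -> mx_homog q (vsval y) ->
    vsval z = sbracket p q (vsval x) (vsval y) ->
    cong (Add (Mul (Gen x) (Gen y))
              (Mul (Sca (- (-1) ^+ (p && q))) (Mul (Gen y) (Gen x))))
         (Gen z).

HB.instance Definition _ := gen_eqMixin expr.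
HB.instance Definition _ := gen_choiceMixin expr.

Definition congb (s t : expr) : bool := `[< cong s t >].

Lemma congb_refl : reflexive congb.
Proof. by move=> s; apply/asboolP; apply: cong_refl. Qed.

Lemma congb_sym s t : congb s t = congb t s.
Proof. by apply/asboolP/asboolP; apply: cong_sym. Qed.

Lemma congb_trans : transitive congb.
Proof.
by move=> t s u /asboolP st /asboolP tu; apply/asboolP; apply: cong_trans tu.
Qed.

Canonical congb_equiv := EquivRel congb congb_refl congb_sym congb_trans.

Definition U : Type := {eq_quot congb_equiv}.
HB.instance Definition _ := Choice.on U.
HB.instance Definition _ := EqQuotient.on U.

Definition cls (s : expr) : U := \pi_U s.

Lemma cls_eq s t : cls s = cls t <-> cong s t.
Proof.
by split=> [/eqmodP/asboolP | st]; last by apply/eqmodP/asboolP.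
Qed.

Lemma clsP (P : U -> Prop) : (forall s, P (cls s)) -> forall u, P u.
Proof. by move=> Ps u; rewrite -[u]reprK; apply: Ps. Qed.

Lemma repr_cls s : cong (repr (cls s)) s.
Proof. by apply/cls_eq; rewrite /cls reprK. Qed.

Definition U_zero : U := cls (Sca 0).
Definition U_one : U := cls (Sca 1).
Definition U_add (u v : U) : U := cls (Add (repr u) (repr v)).
Definition U_mul (u v : U) : U := cls (Mul (repr u) (repr v)).
Definition U_opp (u : U) : U := U_mul (cls (Sca (-1))) u.
Definition U_scale (a : K) (u : U) : U := U_mul (cls (Sca a)) u.

Lemma U_addE s t : U_add (cls s) (cls t) = cls (Add s t).
Proof. by apply/cls_eq; apply: cong_add; apply: repr_cls. Qed.

Lemma U_mulE s t : U_mul (cls s) (cls t) = cls (Mul s t).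
Proof. by apply/cls_eq; apply: cong_mul; apply: repr_cls. Qed.

Lemma U_addA : associative U_add.
Proof.
by elim/clsP=> s; elim/clsP=> t; elim/clsP=> u; rewrite !U_addE;
  apply/cls_eq; apply: cong_addA.
Qed.

Lemma U_addC : commutative U_add.
Proof.
by elim/clsP=> s; elim/clsP=> t; rewrite !U_addE; apply/cls_eq;
  apply: cong_addC.
Qed.

Lemma U_add0 : left_id U_zero U_add.
Proof. by elim/clsP=> s; rewrite U_addE; apply/cls_eq; apply: cong_add0. Qed.

Lemma U_addN : left_inverse U_zero U_opp U_add.
Proof.
by elim/clsP=> s; rewrite /U_opp U_mulE U_addE; apply/cls_eq;
  apply: cong_addN.
Qed.

HB.instance Definition _ :=
  GRing.isZmodule.Build U U_addA U_addC U_add0 U_addN.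

Lemma U_mulA : associative U_mul.
Proof.
by elim/clsP=> s; elim/clsP=> t; elim/clsP=> u; rewrite !U_mulE;
  apply/cls_eq; apply: cong_mulA.
Qed.

Lemma U_scaC a u : U_mul (cls (Sca a)) u = U_mul u (cls (Sca a)).
Proof. by elim/clsP: u => s; rewrite !U_mulE; apply/cls_eq; apply: cong_scaC. Qed.

Lemma U_mul1l : left_id U_one U_mul.
Proof. by elim/clsP=> s; rewrite U_mulE; apply/cls_eq; apply: cong_mul1. Qed.

Lemma U_mul1r : right_id U_one U_mul.
Proof. by move=> u; rewrite -U_scaC; apply: U_mul1l. Qed.

Lemma U_mulDl : left_distributive U_mul U_add.
Proof.
by elim/clsP=> s; elim/clsP=> t; elim/clsP=> u; rewrite !(U_mulE, U_addE);
  apply/cls_eq; apply: cong_mulDl.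
Qed.

Lemma U_mulDr : right_distributive U_mul U_add.
Proof.
by elim/clsP=> s; elim/clsP=> t; elim/clsP=> u; rewrite !(U_mulE, U_addE);
  apply/cls_eq; apply: cong_mulDr.
Qed.

(* The augmentation, which shows that U(g) is not the zero ring. *)
Fixpoint aug (s : expr) : K :=
  match s with
  | Gen _ => 0
  | Sca a => a
  | Add s t => aug s + aug t
  | Mul s t => aug s * aug t
  end.

Lemma aug_cong s t : cong s t -> aug s = aug t.
Proof.
elim=> {s t} //=.
- by move=> s t u _ -> _ ->.
- by move=> s s' t t' _ -> _ ->.
- by move=> s s' t t' _ -> _ ->.
- by move=> s t u; rewrite addrA.
- by move=> s t; rewrite addrC.
- by move=> s; rewrite add0r.
- by move=> s; rewrite mulN1r addNr.
- by move=> s t u; rewrite mulrA.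
- by move=> s t u; rewrite mulrDl.
- by move=> s t u; rewrite mulrDr.
- by move=> s; rewrite mul1r.
- by move=> a s; rewrite mulrC.
- by move=> a _ _; rewrite mulr0 addr0.
- by move=> *; rewrite !mulr0 addr0.
Qed.

Lemma U_one_neq0 : U_one != U_zero.
Proof.
by apply/eqP => /cls_eq/aug_cong /= /eqP; rewrite oner_eq0.
Qed.

HB.instance Definition _ := GRing.Zmodule_isNzRing.Build U
  U_mulA U_mul1l U_mul1r U_mulDl U_mulDr U_one_neq0.

Lemma U_scaleA a b u : U_scale a (U_scale b u) = U_scale (a * b) u.
Proof.
rewrite /U_scale U_mulA U_mulE; congr (U_mul _ u); apply/cls_eq.
by apply: cong_sym; apply: cong_scaM.
Qed.

Lemma U_scale1 : left_id 1 U_scale.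
Proof. exact: U_mul1l. Qed.

Lemma U_scaleDr : right_distributive U_scale +%R.
Proof. by move=> a u v; apply: U_mulDr. Qed.

Lemma U_scaleDl u : {morph U_scale^~ u : a b / a + b}.
Proof.
move=> a b; rewrite /U_scale -[RHS]U_mulDl; congr (U_mul _ u).
by rewrite U_addE; apply/cls_eq; apply: cong_scaD.
Qed.

HB.instance Definition _ := GRing.Zmodule_isLmodule.Build K U
  U_scaleA U_scale1 U_scaleDr U_scaleDl.

Lemma U_scaleAl (a : K) (u v : U) : a *: (u * v) = (a *: u) * v.
Proof. exact: U_mulA. Qed.

HB.instance Definition _ := GRing.Lmodule_isLalgebra.Build K U U_scaleAl.

Lemma U_scaleAr (a : K) (u v : U) : a *: (u * v) = u * (a *: v).
Proof.
rewrite U_scaleAl [a *: u]U_scaC [a *: v]/(U_scale a v).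
by rewrite -[LHS]U_mulA.
Qed.

HB.instance Definition _ := GRing.Lalgebra_isAlgebra.Build K U U_scaleAr.

Definition gen (x : subvs_of g) : U := cls (Gen x).

Lemma gen_linear : linear gen.
Proof.
move=> a x y; rewrite [LHS](_ : _ = cls (Add (Mul (Sca a) (Gen x)) (Gen y))).
  by rewrite -U_addE -U_mulE.
by apply/cls_eq; apply: cong_lin.
Qed.

Lemma gen_bracket p q x y z :
  mx_homog p (vsval x) -> mx_homog q (vsval y) ->
  vsval z = sbracket p q (vsval x) (vsval y) ->
  gen x * gen y - (-1) ^+ (p && q) *: (gen y * gen x) = gen z.
Proof.
move=> hx hy hz; rewrite -scaleNr.
have /cls_eq := cong_bracket hx hy hz; rewrite -/(gen z) => <-.
by rewrite -U_addE -!U_mulE.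
Qed.

(* The Z/2-grading of U(g): U_homog p u says that u is of parity p. *)
Inductive U_homog : bool -> U -> Prop :=
| U_homog0 p : U_homog p 0
| U_homog1 : U_homog false 1
| U_homog_gen p x : mx_homog p (vsval x) -> U_homog p (gen x)
| U_homogD p u v : U_homog p u -> U_homog p v -> U_homog p (u + v)
| U_homogZ p a u : U_homog p u -> U_homog p (a *: u)
| U_homogM p q u v : U_homog p u -> U_homog q v -> U_homog (p (+) q) (u * v).

(* The center in the superalgebra sense: both homogeneous components of z
   supercommute with every homogeneous element. *)
Definition supercentral (z : U) : Prop :=
  exists z0 z1 : U,
    [/\ z = z0 + z1, U_homog false z0, U_homog true z1 &
        forall q u, U_homog q u -> z0 * u = u * z0 /\ z1 * u = (-1) ^+ q * (u * z1)].

End Enveloping.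

Section Queer.
Variables (K : fieldType) (N : nat).

Definition Fmx (i j : 'I_(N + N)) : 'M[K]_(N + N) :=
  delta_mx i j + delta_mx (opp_idx i) (opp_idx j).

Definition qN : {vspace 'M[K]_(N + N)} :=
  <<[seq Fmx i j | i <- enum 'I_(N + N), j <- enum 'I_(N + N)]>>%VS.

Lemma Fmx_in_qN i j : Fmx i j \in qN.
Proof.
by apply/memv_span/allpairs_f; rewrite mem_enum.
Qed.

(* q_N consists of the matrices X with X_{-i,-j} = X_{i,j}; hence it is stable
   under the superbracket, and cong_bracket applies to all homogeneous x, y. *)
Lemma mem_qN (X : 'M[K]_(N + N)) :
  reflect (forall i j, X (opp_idx i) (opp_idx j) = X i j) (X \in qN).
Proof.
have oppE (i j : 'I_(N + N)) : (opp_idx i == j) = (i == opp_idx j).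
  by rewrite -(inj_eq (can_inj (@opp_idxK N))) opp_idxK.
apply: (iffP idP) => [hX|hX].
  move=> i j; rewrite (coord_span (X := in_tuple _) hX) !summxE; apply: eq_bigr => k _.
  rewrite !mxE; congr (_ * _); set Y := _`_k.
  have /allpairsP[[u v] /= [_ _ ->]] :
      Y \in [seq Fmx u v | u <- enum 'I_(N + N), v <- enum 'I_(N + N)].
    by apply: mem_nth.
  by rewrite !mxE !oppE !opp_idxK addrC.
have -> : X = \sum_(k < N) \sum_j X (pos k) j *: Fmx (pos k) j.
  apply/matrixP => i j; rewrite summxE.
  under eq_bigr => k _ do rewrite summxE.
  elim/idxP: i => l; rewrite (bigD1 l) //= [X in _ + X]big1 ?addr0.
  - rewrite (bigD1 j) //= big1 ?addr0.
      rewrite !mxE !eqxx opp_pos /=.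
      by rewrite [pos l == _]eq_lrshift /= addr0 mulr1.
    move=> m ne; rewrite !mxE opp_pos [pos l == neg l]eq_lrshift /= addr0.
    by rewrite [j == m]eq_sym (negPf ne) andbF mulr0.
  - move=> m ne; rewrite big1 // => q _; rewrite !mxE opp_pos.
    rewrite [pos l == neg m]eq_lrshift [pos l == _]eq_lshift.
    by rewrite [l == m]eq_sym (negPf ne) addr0 mulr0.
  - rewrite (bigD1 (opp_idx j)) //= big1 ?addr0.
      rewrite !mxE opp_idxK opp_pos !eqxx [neg l == pos l]eq_rlshift add0r mulr1.
      by rewrite -[RHS]hX opp_idxK opp_pos.
    move=> m ne; rewrite !mxE opp_pos [neg l == pos l]eq_rlshift add0r.
    by rewrite [j == _]eq_sym oppE (negPf ne) andbF mulr0.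
  - move=> m ne; rewrite big1 // => q _; rewrite !mxE opp_pos.
    rewrite [neg l == pos m]eq_rlshift [neg l == _]eq_rshift.
    by rewrite [l == m]eq_sym (negPf ne) addr0 mulr0.
by apply: memv_suml => k _; apply: memv_suml => j _;
  apply: memvZ; apply: Fmx_in_qN.
Qed.

Lemma qN_sbracket p q X Y :
  X \in qN -> Y \in qN -> sbracket p q X Y \in qN.
Proof.
move=> /mem_qN hX /mem_qN hY.
have mulqN (A B : 'M[K]_(N + N)) : (forall i j, A (opp_idx i) (opp_idx j) = A i j) ->
    (forall i j, B (opp_idx i) (opp_idx j) = B i j) -> A *m B \in qN.
  move=> hA hB; apply/mem_qN => i j; rewrite !mxE.
  rewrite (reindex_inj (can_inj (@opp_idxK N))).
  by apply: eq_bigr => k _; rewrite hA hB.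
by rewrite memvB ?memvZ ?mulqN.
Qed.

Definition F (i j : 'I_(N + N)) : U qN := gen (Subvs (Fmx_in_qN i j)).

Definition nplus : {vspace 'M[K]_(N + N)} :=
  (\sum_(i < N) \sum_(j < N | (i < j)%N)
     (<[Fmx (pos i) (pos j)]> + <[Fmx (pos i) (neg j)]>))%VS.

Definition nminus : {vspace 'M[K]_(N + N)} :=
  (\sum_(i < N) \sum_(j < N | (j < i)%N)
     (<[Fmx (pos i) (pos j)]> + <[Fmx (pos i) (neg j)]>))%VS.

(* The subspace n_- U(q_N) + U(q_N) n_+. *)
Inductive HC_kernel : U qN -> Prop :=
| HC_kernel0 : HC_kernel 0
| HC_kernelD u v : HC_kernel u -> HC_kernel v -> HC_kernel (u + v)
| HC_kernel_minus x u : vsval x \in nminus -> HC_kernel (gen x * u)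
| HC_kernel_plus x u : vsval x \in nplus -> HC_kernel (u * gen x).

(* The value in U(q_N) of a polynomial at lambda_i = F_ii. *)
Definition at_Fii (p : {mpoly K[N]}) : U qN :=
  mmap (fun a : K => a%:A) (fun i => F (pos i) (pos i)) p.

(* The polynomial p with z = p(F_11, ..., F_NN) modulo n_- U + U n_+; it exists
   (and is unique) for z central, and HC z is only meant for such z. *)
Definition HC (z : U qN) : {mpoly K[N]} :=
  if pselect (exists p, HC_kernel (z - at_Fii p)) is left h
  then sval (cid h) else 0.

(* The element c_r, for r >= 1. *)
Definition cyclic (r : nat) : U qN :=
  \sum_(i : {ffun 'I_r -> 'I_(N + N)})
     (-1) ^+ (\sum_(k < r | (0 < k)%N) par (i k))%N
       * \prod_(k < r) F (i k) (i (ordS k)).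

(* The element b_r = c_{2r-1}, for r >= 1. *)
Definition odd_cyclic (r : nat) : U qN := cyclic (r.*2.-1).

(* The indices of matrices start at 0, so that entry (i, j) is
   b_{(i+1)+(j+1)-1}.  The determinant is the Leibniz sum taken in U(q_N); as
   the entries are central (and even), the order of the factors is immaterial. *)
Definition Delta : U qN := \det (\matrix_(i < N, j < N) odd_cyclic (i + j).+1).

Definition xlam (i : 'I_N) : {mpoly K[N]} := 'X_i * ('X_i - 1).
Definition ylam (i : 'I_N) : {mpoly K[N]} := 'X_i * ('X_i + 1).

Definition P_poly : {poly {fraction {mpoly K[N]}}} :=
  \prod_(j < N) (1 - tofrac (ylam j) *: 'X).

Definition Q_poly : {poly {fraction {mpoly K[N]}}} :=
  \prod_(i < N) (1 - tofrac (xlam i) *: 'X).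

End Queer.

(* The roots, with multiplicity, of a polynomial that splits over L (such as
   Q_poly), listed in some order. *)
Definition split_roots (L : fieldType) (f : {poly L}) : seq L :=
  if pselect (exists s : seq L, f = lead_coef f *: \prod_(a <- s) ('X - a%:P))
     is left h
  then sval (cid h) else [::].

(* Res(f, g) for f that splits over L.  MathComp's resultant (the determinant of
   its Sylvester matrix) differs from it by the sign (-1)^(deg f * deg g). *)
Definition Res (L : fieldType) (f g : {poly L}) : L :=
  lead_coef f ^+ (size g).-1 * \prod_(a <- split_roots f) g.[a].

(* Main.v *)
(* Let M be the matrix with entries (-1)^j F_ij.  The supercommutators of the
   F_ab with the entries of a power of M have the same form as for M itself;
   hence c_r, which is the supertrace of M^r, is central.  Modulo
   n_- U + U n_+ the same formula gives a triangular recursion for the diagonal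
   entries: with u_i = (M^(2s))_ii one gets (M^(2s+1))_ii = lam_i u_i and
   (M^(2s+2))_ii = x_i u_i - 2 sum_(k > i) lam_k u_k, so that
   HC(b_(s+1)) = 2 sum_i lam_i u_i.  Solving the recursion by partial fractions
   gives HC(b_(s+1)) = sum_m w_m x_m^s with
   w_m = - prod_j (x_m - y_j) / prod_(j <> m) (x_m - x_j).  A Hankel matrix with
   such entries is V diag(w) V^T for the Vandermonde matrix V of the x_m, which
   yields (-1)^C(N,2) prod_m (- prod_j (x_m - y_j)), and
   x_m - y_j = (lam_m + lam_j) (lam_m - lam_j - 1).

   The polynomial HC(z) is unique because there are highest weight modules of
   generic weight.  For this we use N colours of bosonic and fermionic
   oscillators, which represent gl(N|N); in colour c the creation and
   annihilation operators of the indices of absolute value < c are exchanged,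
   and the vacuum then has weight X_c in the c-th coordinate. *)
From HB Require Import structures.
From mathcomp Require Import perm functions ring.
Require Import Defs.

Set Implicit Arguments.
Unset Strict Implicit.
Unset Printing Implicit Defensive.

(** * Centrality *)

Section IndexLemmas.
Variable N : nat.
Implicit Types i j : 'I_(N + N).

Lemma par_opp i : par (opp_idx i) = ~~ par i.
Proof. by elim/idxP: i => k; rewrite ?opp_pos ?opp_neg ?par_pos ?par_neg. Qed.

Lemma opp_idx_eq i j : (opp_idx i == j) = (i == opp_idx j).
Proof. by rewrite -(inj_eq (can_inj (@opp_idxK N))) opp_idxK. Qed.

Lemma opp_idx_neq i : (opp_idx i == i) = false.
Proof.
by apply/negP => /eqP /(congr1 (@par N)); rewrite par_opp; case: (par i).
Qed.

End IndexLemmas.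

Lemma sum_mulr_delta (V : zmodType) (I : finType) (i : I) (f : I -> V) :
  \sum_m f m *+ (i == m) = f i.
Proof.
rewrite (bigD1 i) //= eqxx big1 ?addr0 // => m /negPf.
by rewrite eq_sym => ->.
Qed.

Section Equivariance.
Variables (R : nzRingType) (N : nat) (F : 'I_(N + N) -> 'I_(N + N) -> R).
Implicit Types (a b k l m : 'I_(N + N)).

(* The values of the supercommutators [F_ab, A_kl], with the signs for which
   the condition is stable under matrix products. *)
Definition equivariant (A : 'M[R]_(N + N)) := forall a b k l,
  F a b * A k l =
    (-1) ^+ ((par a (+) par b) && (par k (+) par l)) * (A k l * F a b)
    + (A a l *+ (b == k) + A (opp_idx a) l *+ (opp_idx b == k))
    - (-1) ^+ ((par a (+) par b) && ~~ (par k (+) par l))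
      * (A k b *+ (a == l) + A k (opp_idx b) *+ (opp_idx a == l)).

(** The two correction terms cancel: where they are nonzero, the pair (k, l) has the same total
    parity as (a, b), so their relative sign is trivial. *)
Lemma equivariant1 : equivariant 1%:M.
Proof.
move=> a b k l; rewrite !mxE mulr_natr mulr_natl.
have -> : ((k == b)%:R *+ (a == l) + (k == opp_idx b)%:R *+ (opp_idx a == l)) =
   (-1) ^+ ((par a (+) par b) && ~~ (par k (+) par l)) *
   ((a == l)%:R *+ (b == k) + (opp_idx a == l)%:R *+ (opp_idx b == k)) :> R.
  rewrite mulrDr ![k == _]eq_sym; congr (_ + _).
    case: eqP => [<-|]; case: eqP => [<-|] //=; rewrite ?mulr0 ?mul0rn //.
    by case: (par a) (par b) => [] []; rewrite ?mulr1.
  case: eqP => [<-|]; case: eqP => [<-|] //=; rewrite ?mulr0 ?mul0rn //.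
  by rewrite !par_opp; case: (par a) (par b) => [] []; rewrite ?mulr1.
rewrite signrMK addrK; case: eqP => [->|_]; last by rewrite mulr0.
by rewrite addbb andbF mul1r.
Qed.

(** Leibniz rule. The terms that contract the inner index, A_kb B_al and its analogue for -a, -b,
    arise once from each factor; the sign convention of [equivariant] makes them cancel. *)
Lemma equivariantM A B : equivariant A -> equivariant B -> equivariant (A *m B).
Proof.
move=> eA eB a b k l; rewrite !mxE.
pose p := par a (+) par b.
have key m : F a b * (A k m * B m l) =
  (-1) ^+ (p && (par k (+) par l)) * (A k m * B m l * F a b)
  + (A a m * B m l *+ (b == k) + A (opp_idx a) m * B m l *+ (opp_idx b == k))
  - (-1) ^+ (p && ~~ (par k (+) par l))
    * (A k m * B m b *+ (a == l) + A k m * B m (opp_idx b) *+ (opp_idx a == l))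
  + ((-1) ^+ (p && (par k (+) par m)) * (A k m * B a l) *+ (b == m)
     + (-1) ^+ (p && (par k (+) par m)) * (A k m * B (opp_idx a) l) *+ (opp_idx b == m))
  - ((-1) ^+ (p && ~~ (par k (+) par m)) * (A k b * B m l) *+ (a == m)
     + (-1) ^+ (p && ~~ (par k (+) par m)) * (A k (opp_idx b) * B m l) *+ (opp_idx a == m)).
  have swap (e : bool) y : A k m * ((-1) ^+ e * y) = (-1) ^+ e * (A k m * y).
    by rewrite mulrA [A k m * _]commr_sign mulrA.
  rewrite mulrA eA -/p mulrBl mulrDl -(mulrA _ (A k m * F a b)).
  rewrite -(mulrA (A k m)) eB -/p !mulrBr !mulrDr !swap !mulrA -!signr_addb.
  rewrite -!andb_addr addbA -[(_ (+) par m) (+) par m]addbA addbb addbF.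
  rewrite -[par k (+) par m (+) ~~ _]addbA addbN addbA addbb addFb.
  rewrite -!mulrA !mulrnAr !mulrDl !mulrnAl addbN -!mulrA; congr (_ - _).
  by rewrite addrAC [X in X - _]addrAC [RHS]addrAC.
rewrite mulr_sumr (eq_bigr _ (fun m _ => key m)).
rewrite sumrB !big_split /= !sumrN -!mulr_sumr !big_split /= -mulr_suml.
rewrite !sumrMnl !sum_mulr_delta !par_opp -/p; apply: (canLR (addrK _)).
by congr (_ + (_ + _)); rewrite /p; case: (par a) (par b) (par k) => [] [] [].
Qed.

(** In the supertrace the correction for k = b and the one for k = a are both (-1)^b A_ab and
    cancel; likewise for -a, -b. *)
Lemma equivariant_str (A : 'M[R]_(N + N)) (c := \sum_k (-1) ^+ par k * A k k) :
  equivariant A -> forall a b, F a b * c = c * F a b.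
Proof.
move=> eA a b; rewrite /c mulr_sumr mulr_suml.
have key k : F a b * ((-1) ^+ par k * A k k) = (-1) ^+ par k * A k k * F a b
  + ((-1) ^+ par k * A a k *+ (b == k)
     + (-1) ^+ par k * A (opp_idx a) k *+ (opp_idx b == k))
  - ((-1) ^+ (par k (+) par a (+) par b) * A k b *+ (a == k)
     + (-1) ^+ (par k (+) par a (+) par b) * A k (opp_idx b) *+ (opp_idx a == k)).
  rewrite mulrA [F a b * _]commr_sign -(mulrA _ (F a b)) eA addbb andbF andbT mul1r.
  by rewrite mulrBr !mulrDr !mulrnAr !mulrA -signr_addb !addbA.
rewrite (eq_bigr _ (fun k _ => key k)) sumrB !big_split /= !sum_mulr_delta.
by rewrite !par_opp !addbb !addFb addNb addbb addTb addrK.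
Qed.

End Equivariance.

Section Generators.
Variables (K : fieldType) (N : nat).
Implicit Types (a b k l m : 'I_(N + N)) (r s : nat).
Local Notation U := (U (qN K N)).
Local Notation F := (@Defs.F K N).
Local Open Scope ring_scope.

HB.instance Definition _ :=
  GRing.isLinear.Build K (subvs_of (qN K N)) U *:%R (@gen K N (qN K N))
    (@gen_linear K N (qN K N)).

Lemma F_opp a b : F (opp_idx a) (opp_idx b) = F a b.
Proof.
by congr gen; apply: val_inj; rewrite /= /Fmx !opp_idxK addrC.
Qed.

Lemma Fmx_homog a b : mx_homog (par a (+) par b) (Fmx K a b).
Proof.
move=> i j; rewrite !mxE; case: (eqVneq i a) => [->|_] /=.
  case: (eqVneq j b) => [->//|_]; rewrite add0r.
  by rewrite [a == _]eq_sym opp_idx_neq eqxx.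
rewrite add0r; case: (eqVneq i (opp_idx a)) => [->|_] /=; last by rewrite eqxx.
case: (eqVneq j (opp_idx b)) => [->|_] /=; last by rewrite eqxx.
by rewrite !par_opp addbN addNb negbK.
Qed.

Lemma Fmx_mul a b k l :
  Fmx K a b *m Fmx K k l
  = Fmx K a l *+ (b == k) + Fmx K (opp_idx a) l *+ (opp_idx b == k).
Proof.
rewrite /Fmx mulmxDl !mulmxDr !mul_delta_mx_cond opp_idxK.
rewrite !mulrnDl -!addrA; congr (_ + _).
rewrite [b == opp_idx k]eq_sym [opp_idx k == b]opp_idx_eq [k == _]eq_sym.
rewrite (inj_eq (can_inj (@opp_idxK N))).
by rewrite addrCA addrC -addrA addrCA [X in _ + X]addrC.
Qed.

Definition Fsgn : 'M[U]_(N + N) := \matrix_(i, j) ((-1) ^+ par j * F i j).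

Lemma F_bracket a b k l :
  F a b * F k l =
    (-1) ^+ ((par a (+) par b) && (par k (+) par l)) * (F k l * F a b)
    + (F a l *+ (b == k) + F (opp_idx a) l *+ (opp_idx b == k))
    - (-1) ^+ ((par a (+) par b) && (par k (+) par l))
      * (F k b *+ (a == l) + F k (opp_idx b) *+ (opp_idx a == l)).
Proof.
set e := _ && _.
pose w (i j : 'I_(N + N)) := Subvs (Fmx_in_qN K i j).
pose z := (w a l *+ (b == k) + w (opp_idx a) l *+ (opp_idx b == k))
   - (-1) ^+ e *: (w k b *+ (a == l) + w k (opp_idx b) *+ (opp_idx a == l)).
have := @gen_bracket K N (qN K N) _ _ (w a b) (w k l) z
  (@Fmx_homog a b) (@Fmx_homog k l).
have -> : vsval z = sbracket (par a (+) par b) (par k (+) par l)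
   (vsval (w a b)) (vsval (w k l)).
  rewrite /z /sbracket !Fmx_mul -/e linearB linearZ /= !linearD /= !linearMn /=.
  have -> : Fmx K (opp_idx k) b = Fmx K k (opp_idx b).
    by rewrite /Fmx !opp_idxK addrC.
  rewrite [l == a]eq_sym [opp_idx l == a]opp_idx_eq [l == opp_idx a]eq_sym.
  by rewrite !scalerN.
move=> /(_ erefl) /(canRL (subrK _)) ->.
rewrite /z linearB linearZ /= !linearD /= !linearMn /= -!/(F _ _).
rewrite !scaler_sign !mulr_sign -/e [LHS]addrC -[RHS]addrA; congr (_ + (_ + _)).
by case: (e); rewrite ?opprD ?opprK ?mulNrn.
Qed.

(** The second correction of [F_bracket] moves from column l = a or -a to column b or -b. The column
    signs of [Fsgn] thus contribute (-1)^(a+b), which negates the parity of (k, l) in the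
    exponent. *)
Lemma equivariant_Fsgn : equivariant F Fsgn.
Proof.
move=> a b k l; rewrite !mxE mulrA [F a b * _]commr_sign -mulrA F_bracket.
rewrite mulrBr mulrDr; congr (_ + _ - _).
- by rewrite !mulrA; congr (_ * _ * _); rewrite -!signr_addb addbC.
- by rewrite mulrDr !mulrnAr.
rewrite !mulrA -!signr_addb !mulrDr !mulrnAr !mulrA -!signr_addb.
congr (_ + _); case: eqP => //= e.
  by rewrite -e; case: (par a) (par b) (par k) => [] [] [].
by rewrite -e !par_opp; case: (par a) (par b) (par k) => [] [] [].
Qed.

Definition Fpow r : 'M[U]_(N + N) := iter r (mulmx Fsgn) 1%:M.

Lemma equivariant_Fpow r : equivariant F (Fpow r).
Proof.
elim: r => [|r IH]; first exact: equivariant1.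
exact: equivariantM equivariant_Fsgn IH.
Qed.

(** One sign per factor: F_{-a,-b} = F_ab, while the column sign (-1)^b changes. *)
Lemma Fpow_opp r a b : Fpow r (opp_idx a) (opp_idx b) = (-1) ^+ r * Fpow r a b.
Proof.
elim: r a b => [|r IH] a b.
  by rewrite !mxE mul1r (inj_eq (can_inj (@opp_idxK N))).
rewrite !mxE mulr_sumr (reindex_inj (can_inj (@opp_idxK N))) /=.
apply: eq_bigr => m _; rewrite IH !mxE par_opp F_opp exprS signrN mulNr.
by rewrite mulN1r !mulNr !mulrA; congr (- (_ * _)); rewrite commr_sign mulrA.
Qed.

(** Summing over all pairs (i, j) counts F_ij = F_{-i,-j} twice. This avoids the choice of a basis
    of q_N at the price of a division by 2. *)
Lemma double_gen x : gen x *+ 2 = \sum_i \sum_j vsval x i j *: F i j.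
Proof.
have -> : \sum_i \sum_j vsval x i j *: F i j =
   gen (\sum_i \sum_j vsval x i j *: Subvs (Fmx_in_qN K i j)).
  rewrite linear_sum; apply: eq_bigr => i _; rewrite linear_sum.
  by apply: eq_bigr => j _; rewrite linearZ.
rewrite mulr2n -linearD; congr gen; apply: val_inj; rewrite linearD linear_sum /=.
have /mem_qN sym := subvsP x.
rewrite {1}[vsval x]matrix_sum_delta [X in _ + X]matrix_sum_delta.
rewrite [X in _ + X](reindex_inj (can_inj (@opp_idxK N))) -big_split.
apply: eq_bigr => i _; rewrite linear_sum /=.
rewrite [X in _ + X](reindex_inj (can_inj (@opp_idxK N))) -big_split.
by apply: eq_bigr => j _; rewrite /Fmx scalerDr sym.
Qed.

Hypothesis char2 : 2%:R != 0 :> K.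

Lemma gen_sum x : gen x = \sum_i \sum_j (2%:R^-1 * vsval x i j) *: F i j.
Proof.
under eq_bigr => i _ do
  [under eq_bigr => j _ do rewrite -scalerA; rewrite -scaler_sumr].
by rewrite -scaler_sumr -double_gen -[gen x *+ 2]scaler_nat scalerA mulVf ?scale1r.
Qed.

Lemma commute_gens (z : U) : (forall a b, F a b * z = z * F a b) ->
  forall u, u * z = z * u.
Proof.
move=> zF; elim/clsP; elim=> [x|a|s IHs t IHt|s IHs t IHt].
- rewrite -/(gen x) gen_sum mulr_suml mulr_sumr; apply: eq_bigr => i _.
  rewrite mulr_suml mulr_sumr; apply: eq_bigr => j _.
  by rewrite -scalerAl -scalerAr zF.
- exact: U_scaC.
- have -> : cls (Add s t) = cls s + cls t :> U by rewrite -U_addE.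
  by rewrite mulrDl mulrDr IHs IHt.
have -> : cls (Mul s t) = cls s * cls t :> U by rewrite -U_mulE.
by rewrite mulrA -IHs -!mulrA IHt.
Qed.

End Generators.

(** * Powers of a matrix as sums over walks *)

Section ClosedWalks.
Variable R : nzRingType.

Lemma prod_sign (I : finType) (s : seq I) (e : I -> nat) (x : I -> R) :
  \prod_(k <- s) ((-1) ^+ e k * x k)
  = (-1) ^+ (\sum_(k <- s) e k)%N * \prod_(k <- s) x k.
Proof.
elim: s => [|k s IH]; first by rewrite !big_nil mul1r.
rewrite !big_cons IH exprD -!mulrA; congr (_ * _).
by rewrite !mulrA; congr (_ * _); rewrite commr_sign.
Qed.

Variables (n : nat) (A : 'M[R]_n).

Fixpoint walk_weight (i : 'I_n) (s : seq 'I_n) (j : 'I_n) : R :=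
  if s is x :: s' then A i x * walk_weight x s' j else A i j.

Lemma walk_weightE i s j :
  walk_weight i s j
  = \prod_(k < (size s).+1) A (nth j (i :: s) k) (nth j (rcons s j) k).
Proof.
elim: s i => [|x s IH] i /=; first by rewrite big_ord1.
by rewrite big_ord_recl IH.
Qed.

Lemma iter_mulmx_walks r i j :
  iter r.+1 (mulmx A) 1%:M i j = \sum_(t : r.-tuple 'I_n) walk_weight i t j.
Proof.
elim: r i => [|r IH] i.
  rewrite /= mulmx1 (bigD1 [tuple]) //= big1 ?addr0 // => t /eqP [].
  exact: tuple0.
rewrite iterS !mxE.
rewrite (reindex (fun p : 'I_n * r.-tuple 'I_n => [tuple of p.1 :: p.2])) /=.
  rewrite -(pair_bigA _ (fun x t => A i x * walk_weight x (t : r.-tuple _) j)) /=.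
  by apply: eq_bigr => x _; rewrite IH mulr_sumr.
exists (fun t => (thead t, [tuple of behead t])) => [[x t] _|t _] /=.
  by congr (_, _); apply: val_inj.
by rewrite [RHS]tuple_eta.
Qed.

(** As [ordS] is the cyclic successor, f is a closed walk; splitting off its base point f 0 yields a
    diagonal entry of A^(r+1). *)
Lemma sum_closed_walks (w : 'I_n -> R) r :
  \sum_(f : {ffun 'I_r.+1 -> 'I_n})
    w (f ord0) * \prod_(k < r.+1) A (f k) (f (ordS k))
  = \sum_i w i * iter r.+1 (mulmx A) 1%:M i i.
Proof.
under [RHS]eq_bigr => i _ do rewrite iter_mulmx_walks mulr_sumr.
rewrite pair_big /=.
rewrite (reindex (fun p : 'I_n * r.-tuple 'I_n =>
                   [ffun k => tnth [tuple of p.1 :: p.2] k])) /=.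
  apply: eq_bigr => -[i t] _ /=.
  have -> : walk_weight i t i
      = \prod_(k < r.+1) A (nth i (i :: t) k) (nth i (rcons t i) k).
    by rewrite walk_weightE size_tuple.
  rewrite ffunE; congr (_ * _).
  apply: eq_bigr => k _; rewrite !ffunE !(tnth_nth i) /=; congr (A _ _).
  have [kr|kr] := ltnP k r.
    by rewrite modn_small ?ltnS //= nth_rcons size_tuple kr.
  have -> : k = r :> nat by apply/eqP; rewrite eqn_leq kr -ltnS ltn_ord.
  by rewrite modnn /= nth_rcons size_tuple ltnn eqxx.
exists (fun f => (f ord0, [tuple f (lift ord0 k) | k < r])) => [[i t] _|f _] /=.
  rewrite ffunE; congr (_, _); apply: eq_from_tnth => k.
  by rewrite tnth_mktuple ffunE tnthS.
apply/ffunP => k; rewrite ffunE; case: (unliftP ord0 k) => [k' ->|->].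
  by rewrite tnthS tnth_mktuple.
by rewrite tnth0.
Qed.

End ClosedWalks.

Section Cyclic.
Variables (K : fieldType) (N : nat).
Local Notation U := (U (qN K N)).
Local Notation F := (@Defs.F K N).

(** The column signs of the r factors involve the parities of all of i_1, ..., i_r; the weight
    (-1)^(i_1) of the supertrace removes that of i_1, as in the definition of c_r. *)
Lemma cyclicE r : (0 < r)%N ->
  cyclic K N r = \sum_k (-1) ^+ par k * Fpow K N r k k.
Proof.
case: r => // r _.
rewrite -sum_closed_walks; apply: eq_bigr => f _.
under [in RHS]eq_bigr => k _ do rewrite mxE.
rewrite prod_sign mulrA -exprD; congr (_ * _).
have <- : (\sum_(k < r.+1) par (f k) = \sum_(k < r.+1) par (f (ordS k)))%N.
  by rewrite (reindex_inj (@ordS_inj _)).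
rewrite [in RHS](bigD1 ord0) //= addnA [(par _ + par _)%N]addnn exprD.
rewrite -[in RHS]signr_odd odd_double.
by rewrite mul1r; congr (_ ^+ _); apply: eq_bigl => k; rewrite lt0n.
Qed.

Lemma cyclic_comm r : (0 < r)%N -> 2%:R != 0 :> K ->
  forall u : U, u * cyclic K N r = cyclic K N r * u.
Proof.
move=> r0 char2; apply: commute_gens => // a b; rewrite cyclicE //.
by apply: (@equivariant_str _ _ F (Fpow K N r)); apply: equivariant_Fpow.
Qed.

Lemma U_homog_sum (I : finType) p (f : I -> U) :
  (forall i, U_homog p (f i)) -> U_homog p (\sum_i f i).
Proof. by move=> hf; apply: big_ind => //; [apply: U_homog0|apply: U_homogD]. Qed.

Lemma U_homog_sign p (b : bool) (u : U) : U_homog p u -> U_homog p ((-1) ^+ b * u).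
Proof. by move=> hu; rewrite mulr_sign -scaler_sign; apply: U_homogZ. Qed.

Lemma U_homog_Fpow r a b : U_homog (par a (+) par b) (Fpow K N r a b).
Proof.
elim: r a b => [|r IH] a b.
  rewrite mxE; case: eqP => [->|_]; last exact: U_homog0.
  by rewrite addbb; apply: U_homog1.
rewrite mxE; apply: U_homog_sum => m; rewrite mxE.
have -> : par a (+) par b = (par a (+) par m) (+) (par m (+) par b).
  by rewrite addbA -[(_ (+) par m) (+) par m]addbA addbb addbF.
apply: U_homogM (IH _ _); apply: U_homog_sign; apply: U_homog_gen.
exact: Fmx_homog.
Qed.

Lemma U_homog_cyclic r : (0 < r)%N -> U_homog false (cyclic K N r).
Proof.
move=> r0; rewrite cyclicE //; apply: U_homog_sum => k; apply: U_homog_sign.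
by rewrite -[false](addbb (par k)); apply: U_homog_Fpow.
Qed.

Lemma odd_cyclic_gt0 r : (0 < r)%N -> (0 < r.*2.-1)%N.
Proof. by case: r. Qed.

Lemma U_homog_Delta : U_homog false (Delta K N).
Proof.
apply: U_homog_sum => s; apply: U_homog_sign.
elim/big_ind: _ => [|u v hu hv|i _]; first exact: U_homog1.
  by rewrite -[false]/(false (+) false); apply: U_homogM.
by rewrite mxE; apply: U_homog_cyclic; apply: odd_cyclic_gt0.
Qed.

Lemma Delta_comm : 2%:R != 0 :> K ->
  forall u : U, u * Delta K N = Delta K N * u.
Proof.
move=> char2 u; rewrite mulr_sumr mulr_suml; apply: eq_bigr => s _.
rewrite mulrA commr_sign -!mulrA; congr (_ * _).
elim/big_ind: _ => [|x y hx hy|i _]; first by rewrite mulr1 mul1r.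
  by rewrite mulrA hx -!mulrA hy.
by rewrite mxE cyclic_comm //; apply: odd_cyclic_gt0.
Qed.

Lemma supercentral_even (z : U) :
  U_homog false z -> (forall u, u * z = z * u) -> supercentral z.
Proof.
move=> hz zC; exists z, 0; split; rewrite ?addr0 //; first exact: U_homog0.
by move=> q u _; rewrite zC mul0r !mulr0.
Qed.

End Cyclic.

Section AbsoluteIndex.
Variable N : nat.

(** The order of |i| and |j| decides whether F_ij lies in n_-, in the Cartan subalgebra or in
    n_+. *)
Definition abs_idx (i : 'I_(N + N)) : 'I_N :=
  match split i with inl k => k | inr k => k end.

Lemma abs_pos k : abs_idx (pos k) = k.
Proof. by rewrite /abs_idx /pos (unsplitK (inl k)). Qed.

Lemma abs_neg k : abs_idx (neg k) = k.
Proof. by rewrite /abs_idx /neg (unsplitK (inr k)). Qed.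

Lemma abs_opp i : abs_idx (opp_idx i) = abs_idx i.
Proof. by elim/idxP: i => k; rewrite ?opp_pos ?opp_neg ?abs_pos ?abs_neg. Qed.

End AbsoluteIndex.

(** * The subspace n_- U + U n_+ and its stability under the Cartan subalgebra *)

Section Kernel.
Variables (K : fieldType) (N : nat).
Hypothesis char2 : 2%:R != 0 :> K.
Local Notation U := (U (qN K N)).
Local Notation F := (@Defs.F K N).
Local Notation ker := (@HC_kernel K N).
Implicit Types (a b i j : 'I_(N + N)) (k l : 'I_N) (u v z : U).

Lemma Fmx_opp i j : Fmx K (opp_idx i) (opp_idx j) = Fmx K i j.
Proof. by rewrite /Fmx !opp_idxK addrC. Qed.

Lemma Fmx_nminus i j : (abs_idx j < abs_idx i)%N -> Fmx K i j \in nminus K N.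
Proof.
have main k b : (abs_idx b < k)%N -> Fmx K (pos k) b \in nminus K N.
  move=> lt; apply: (subvP (sumv_sup k _ (subvv _))) => //.
  apply: (subvP (sumv_sup (abs_idx b) lt (subvv _))).
  elim/idxP: b {lt} => l; rewrite ?abs_pos ?abs_neg.
    by rewrite (subvP (addvSl _ _)) ?memv_line.
  by rewrite (subvP (addvSr _ _)) ?memv_line.
elim/idxP: i => k; rewrite ?abs_pos ?abs_neg; first exact: main.
by move=> lt; rewrite -Fmx_opp opp_neg main ?abs_opp.
Qed.

Lemma Fmx_nplus i j : (abs_idx i < abs_idx j)%N -> Fmx K i j \in nplus K N.
Proof.
have main k b : (k < abs_idx b)%N -> Fmx K (pos k) b \in nplus K N.
  move=> lt; apply: (subvP (sumv_sup k _ (subvv _))) => //.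
  apply: (subvP (sumv_sup (abs_idx b) lt (subvv _))).
  elim/idxP: b {lt} => l; rewrite ?abs_pos ?abs_neg.
    by rewrite (subvP (addvSl _ _)) ?memv_line.
  by rewrite (subvP (addvSr _ _)) ?memv_line.
elim/idxP: i => k; rewrite ?abs_pos ?abs_neg; first exact: main.
by move=> lt; rewrite -Fmx_opp opp_neg main ?abs_opp.
Qed.

Lemma ker_minus i j u : (abs_idx j < abs_idx i)%N -> ker (F i j * u).
Proof. by move=> lt; apply: HC_kernel_minus; apply: Fmx_nminus. Qed.

Lemma ker_plus i j u : (abs_idx i < abs_idx j)%N -> ker (u * F i j).
Proof. by move=> lt; apply: HC_kernel_plus; apply: Fmx_nplus. Qed.

(** Stated for a general relation P so as to cover n_+ (k < l) and n_- (l < k) at once. *)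
Lemma triangular_coef (P : 'I_N -> 'I_N -> bool) X i j :
  X \in (\sum_k \sum_(l | P k l)
     (<[Fmx K (pos k) (pos l)]> + <[Fmx K (pos k) (neg l)]>))%VS ->
  ~~ P (abs_idx i) (abs_idx j) -> X i j = 0.
Proof.
case/memv_sumP => Y hY -> nP; rewrite summxE big1 // => k _.
have /memv_sumP[Z hZ ->] := hY k isT; rewrite summxE big1 // => l Pkl.
have /memv_addP[_ /vlineP[c ->] [_ /vlineP[d ->] ->]] := hZ l Pkl.
have coef b : abs_idx b = l -> Fmx K (pos k) b i j = 0.
  move=> bl; rewrite !mxE.
  case: (eqVneq i (pos k)) => [ik|_]; case: (eqVneq j b) => [jb|_] /=.
  - by rewrite ik jb abs_pos bl Pkl in nP.
  - rewrite add0r; case: eqP => //= ik'; case: eqP => //= jb.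
    by rewrite ik' jb !abs_opp abs_pos bl Pkl in nP.
  - rewrite add0r; case: eqP => //= ik; case: eqP => //= jb'.
    by rewrite ik jb' !abs_opp abs_pos bl Pkl in nP.
  rewrite add0r; case: eqP => //= ik; case: eqP => //= jb.
  by rewrite ik jb !abs_opp abs_pos bl Pkl in nP.
by rewrite [LHS]mxE [X in X + _]mxE [X in _ + X]mxE !coef ?abs_pos ?abs_neg ?mulr0 ?addr0.
Qed.

Lemma ker_sum (I : Type) (s : seq I) (P : pred I) (f : I -> U) :
  (forall x, P x -> ker (f x)) -> ker (\sum_(x <- s | P x) f x).
Proof.
by move=> hf; apply: big_ind => //; [apply: HC_kernel0|apply: HC_kernelD].
Qed.

Lemma kerZ c z : ker z -> ker (c *: z).
Proof.
elim=> [|u v _ hu _ hv|x u hx|x u hx].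
- by rewrite scaler0; apply: HC_kernel0.
- by rewrite scalerDr; apply: HC_kernelD.
- by rewrite scalerAr; apply: HC_kernel_minus.
by rewrite scalerAl; apply: HC_kernel_plus.
Qed.

Lemma kerN z : ker z -> ker (- z).
Proof. by rewrite -scaleN1r; apply: kerZ. Qed.

Lemma kerB u v : ker u -> ker v -> ker (u - v).
Proof. by move=> hu hv; apply: HC_kernelD => //; apply: kerN. Qed.

Lemma ker_sign (b : bool) z : ker z -> ker ((-1) ^+ b * z).
Proof. by rewrite mulr_sign -scaler_sign; apply: kerZ. Qed.

Lemma kerMn (n : nat) z : ker z -> ker (z *+ n).
Proof. by rewrite -scaler_nat; apply: kerZ. Qed.

(** Reduces general elements of n_- and n_+ to the F_ij, to which the explicit bracket applies.
    Elements are expanded by [gen_sum]; coefficients outside the triangle vanish, and the others are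
    absorbed into u. *)
Lemma ker_ind (P : U -> Prop) : P 0 -> (forall u v, P u -> P v -> P (u + v)) ->
  (forall i j u, (abs_idx j < abs_idx i)%N -> P (F i j * u)) ->
  (forall i j u, (abs_idx i < abs_idx j)%N -> P (u * F i j)) ->
  forall z, ker z -> P z.
Proof.
move=> P0 PD Pm Pp z; elim=> // {z} [u v _ Pu _|x u hx|x u hx]; first exact: PD.
  rewrite (gen_sum char2) mulr_suml; apply: big_ind => // i _.
  rewrite mulr_suml; apply: big_ind => // j _.
  rewrite -scalerAl scalerAr; have [/Pm//|le] := ltnP (abs_idx j) (abs_idx i).
  by rewrite (triangular_coef hx) ?mulr0 ?scale0r ?mulr0 -?leqNgt.
rewrite (gen_sum char2) mulr_sumr; apply: big_ind => // i _.
rewrite mulr_sumr; apply: big_ind => // j _.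
rewrite -scalerAr scalerAl; have [/Pp//|le] := ltnP (abs_idx i) (abs_idx j).
by rewrite (triangular_coef hx) ?mulr0 ?scale0r ?mul0r -?leqNgt.
Qed.

(** The Cartan element F_ab normalises n_-, so it can be moved past a left factor from n_-. In
    [kerMr] the same is done on the right with n_+. *)
Lemma kerMl a b z : abs_idx a = abs_idx b -> ker z -> ker (F a b * z).
Proof.
move=> ab; elim/ker_ind: z / => [|u v hu hv|i j u lt|i j u lt].
- by rewrite mulr0; apply: HC_kernel0.
- by rewrite mulrDr; apply: HC_kernelD.
- rewrite mulrA F_bracket mulrBl mulrDl -!mulrA !mulrDl !mulrnAl.
  apply: kerB; last apply: ker_sign; first apply: HC_kernelD.
  + by apply: ker_sign; apply: ker_minus.
  + apply: HC_kernelD; case: eqP => [e|_]; try exact: HC_kernel0.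
      by apply: ker_minus; rewrite ab e.
    by apply: ker_minus; rewrite abs_opp ab -(abs_opp b) e.
  apply: HC_kernelD; case: eqP => [e|_]; try exact: HC_kernel0.
    by apply: ker_minus; rewrite -ab e.
  by apply: ker_minus; rewrite abs_opp -ab -(abs_opp a) e.
by rewrite mulrA; apply: ker_plus.
Qed.

Lemma kerMr a b z : abs_idx a = abs_idx b -> ker z -> ker (z * F a b).
Proof.
move=> ab; elim/ker_ind: z / => [|u v hu hv|i j u lt|i j u lt].
- by rewrite mul0r; apply: HC_kernel0.
- by rewrite mulrDl; apply: HC_kernelD.
- by rewrite -mulrA; apply: ker_minus.
rewrite -mulrA F_bracket mulrBr mulrDr !mulrA ![_ * (-1) ^+ _]commr_sign -!mulrA.
rewrite !mulrDr !mulrnAr.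
apply: kerB; apply: HC_kernelD.
- by apply: ker_sign; rewrite mulrA; apply: ker_plus.
- apply: HC_kernelD; case: eqP => [e|_]; try exact: HC_kernel0.
    by apply: ker_plus; rewrite -ab -e.
  by apply: ker_plus; rewrite abs_opp -ab -e abs_opp.
- case: eqP => [e|_]; last exact: HC_kernel0.
  by apply: ker_sign; apply: ker_plus; rewrite ab -e.
case: eqP => [e|_]; last exact: HC_kernel0.
by apply: ker_sign; apply: ker_plus; rewrite abs_opp ab -e abs_opp.
Qed.

End Kernel.

(** * Harish-Chandra images of the odd cyclic elements *)

Lemma sub_add_common (V : zmodType) (p q a b c : V) :
  (p + a - b) - (q + a - c) = (p - q) + (c - b).
Proof.
rewrite [p + a - b]addrAC [q + a - c]addrAC opprD addrACA subrr addr0 opprB.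
by rewrite [c - q]addrC addrACA [- b + c]addrC.
Qed.

(* For lam = 'X_i and x = xlam, diag_eig s i is the eigenvalue of the entry
   (i, i) of Fsgn^(2s) on a highest weight vector of weight lam. *)
Fixpoint diag_eig (R : comNzRingType) N (lam x : 'I_N -> R) (s : nat) (i : 'I_N) : R :=
  if s is s'.+1 then
    x i * diag_eig lam x s' i
      - (\sum_(k < N | (i < k)%N) lam k * diag_eig lam x s' k) *+ 2
  else 1.

Lemma rmorph_diag_eig (R S : comNzRingType) (f : {rmorphism R -> S}) N
    (lam x : 'I_N -> R) s i :
  f (diag_eig lam x s i) = diag_eig (f \o lam) (f \o x) s i.
Proof.
elim: s i => [|s IH] i; first exact: rmorph1.
rewrite /= rmorphB rmorphM rmorphMn rmorph_sum IH; congr (_ - _ *+ 2).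
by apply: eq_bigr => k _; rewrite rmorphM IH.
Qed.

Section HarishChandra.
Variables (K : fieldType) (N : nat).
Local Notation U := (U (qN K N)).
Local Notation F := (@Defs.F K N).
Local Notation ker := (@HC_kernel K N).
Local Notation at_ := (@at_Fii K N).
Implicit Types (i k l : 'I_N) (u v w z : U) (p q : {mpoly K[N]}).

Lemma at_FiiE p : at_ p = mmap (in_alg U) (fun i => F (pos i) (pos i)) p.
Proof. by []. Qed.

Lemma ker_trans u v w : ker (u - v) -> ker (v - w) -> ker (u - w).
Proof. by move=> uv vw; rewrite -(subrKA v); apply: HC_kernelD. Qed.

Lemma Fdiag_comm i l : F (pos i) (pos i) * F (pos l) (pos l)
  = F (pos l) (pos l) * F (pos i) (pos i).
Proof.
rewrite F_bracket !par_pos !opp_pos mul1r ![neg i == _]eq_rlshift addr0 mul1r addr0.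
have [->|] := eqVneq (pos i) (pos l); last by rewrite !mulr0n addr0 subr0.
by rewrite !mulr1n addrK.
Qed.

Lemma at_B p q : at_ (p - q) = at_ p - at_ q.
Proof. by rewrite !at_FiiE mmapB. Qed.

Lemma at_D p q : at_ (p + q) = at_ p + at_ q.
Proof. by rewrite !at_FiiE mmapD. Qed.

Lemma at_0 : at_ 0 = 0.
Proof. by rewrite !at_FiiE mmap0. Qed.

Lemma at_sum (I : Type) (s : seq I) (P : pred I) (f : I -> {mpoly K[N]}) :
  at_ (\sum_(x <- s | P x) f x) = \sum_(x <- s | P x) at_ (f x).
Proof. exact: (big_morph _ at_D at_0). Qed.

Lemma at_Mn p n : at_ (p *+ n) = at_ p *+ n.
Proof. by rewrite !at_FiiE mmapMn. Qed.

(** U is not commutative; evaluation at lambda_i = F_ii is nevertheless multiplicative because the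
    F_ii commute with each other. *)
Lemma mmap1_mulFdiag (m m' : 'X_{1..N}) :
  let e := mmap1 (fun i => F (pos i) (pos i)) in e (m + m')%MM = e m * e m' :> U.
Proof.
rewrite /mmap1 /=; elim: (index_enum _) => [|i s IH]; first by rewrite !big_nil mulr1.
rewrite !big_cons IH mnmDE exprD -!mulrA; congr (_ * _).
rewrite !mulrA; congr (_ * _); apply: commr_prod => l _.
exact/commrX/commr_sym/commrX/commr_sym/Fdiag_comm.
Qed.

Lemma at_Z c p : at_ (c *: p) = c *: at_ p.
Proof. by rewrite !at_FiiE mmapZ mulr_algl. Qed.

Lemma at_M p q : at_ (p * q) = at_ p * at_ q.
Proof.
rewrite [p]mpolyE [q]mpolyE mulr_suml !at_sum mulr_suml; apply: eq_bigr => m _.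
rewrite mulr_sumr at_sum mulr_sumr; apply: eq_bigr => m' _.
rewrite -scalerAl -scalerAr scalerA !at_Z -mpolyXD.
rewrite -scalerAl -scalerAr scalerA; congr (_ *: _).
by rewrite !at_FiiE !mmapX mmap1_mulFdiag.
Qed.

Lemma at_1 : at_ 1 = 1.
Proof. by rewrite at_FiiE -mpolyC1 mmapC /= scale1r. Qed.

Lemma at_X i : at_ 'X_i = F (pos i) (pos i).
Proof. by rewrite at_FiiE mmapX mmap1U. Qed.

Hypothesis char2 : 2%:R != 0 :> K.

Lemma ker_at z p : ker z -> ker (z * at_ p).
Proof.
move=> kz; rewrite [p]mpolyE at_sum mulr_sumr; apply: ker_sum => m _.
rewrite at_Z -scalerAr; apply: kerZ; rewrite at_FiiE mmapX /mmap1.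
move: z kz; apply: (big_ind (fun w => forall z, ker z -> ker (z * w))).
- by move=> z; rewrite mulr1.
- by move=> u v hu hv z kz; rewrite mulrA; apply/hv/hu.
move=> i _; elim: (m i) => [|n IH] z kz; first by rewrite mulr1.
by rewrite exprS mulrA; apply/IH/kerMr.
Qed.

Lemma ker_Fdiag_at i z p : ker (z - at_ p) -> ker (F (pos i) (pos i) * z - at_ ('X_i * p)).
Proof. by move=> kz; rewrite at_M at_X -mulrBr; apply: kerMl. Qed.

(** Multiplicativity of the Harish-Chandra projection: z z' - p p' = z (z' - p') + (z - p) p'. A
    central z passes through n_-, and p' acts by Cartan elements. *)
Lemma ker_central z p z' p' : (forall u, u * z = z * u) ->
  ker (z - at_ p) -> ker (z' - at_ p') -> ker (z * z' - at_ (p * p')).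
Proof.
move=> zC kz kz'.
have -> : z * z' - at_ (p * p') = z * (z' - at_ p') + (z - at_ p) * at_ p'.
  by rewrite at_M mulrBr mulrBl addrA subrK.
apply: HC_kernelD; last exact: ker_at.
elim: kz' => [|u v _ hu _ hv|x u hx|x u hx].
- by rewrite mulr0; apply: HC_kernel0.
- by rewrite mulrDr; apply: HC_kernelD.
- by rewrite mulrA -zC -mulrA; apply: HC_kernel_minus.
by rewrite mulrA; apply: HC_kernel_plus.
Qed.

Lemma ker_det n (A : 'M[U]_n) (B : 'M[{mpoly K[N]}]_n) :
  (forall a b u, u * A a b = A a b * u) ->
  (forall a b, ker (A a b - at_ (B a b))) -> ker (\det A - at_ (\det B)).
Proof.
move=> AC AB; rewrite at_sum -sumrB; apply: ker_sum => s _.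
rewrite !mulr_sign -[X in at_ X]scaler_sign at_Z -scaler_sign -scalerBr.
apply: kerZ.
(* [ker_central] wants a central left factor, so centrality of the partial products is carried along
   with the congruence. *)
suff [] : (forall u, u * (\prod_i A i (s i)) = \prod_i A i (s i) * u)
    /\ ker (\prod_i A i (s i) - at_ (\prod_i B i (s i))) by [].
apply: (big_ind2 (fun z p => (forall u, u * z = z * u) /\ ker (z - at_ p))).
- by split=> [u|]; rewrite ?mulr1 ?mul1r // at_1 subrr; apply: HC_kernel0.
- move=> z p z' p' [zC kz] [zC' kz']; split; last exact: ker_central.
  by move=> u; rewrite mulrA zC -!mulrA zC'.
by move=> i _; split; [apply: AC|apply: AB].
Qed.

(** The superbracket of the odd element F_{i,-i} with itself is twice its square, and equals 2
    F_ii. *)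
Lemma F_odd_sqr i : F (pos i) (neg i) * F (pos i) (neg i) = F (pos i) (pos i).
Proof.
have := F_bracket K (pos i) (neg i) (pos i) (neg i).
rewrite !par_pos !par_neg opp_pos opp_neg !eqxx /= eq_rlshift eq_lrshift /=.
have -> : F (neg i) (neg i) = F (pos i) (pos i) by rewrite -opp_pos F_opp.
rewrite !add0r !mulr1n expr1 !mulN1r opprK -addrA.
move/(canLR (addNKr _)); rewrite -!mulr2n => FF.
by apply: (scalerI char2); rewrite !scaler_nat.
Qed.

Lemma F_odd_comm i :
  F (pos i) (pos i) * F (pos i) (neg i) = F (pos i) (neg i) * F (pos i) (pos i).
Proof.
rewrite F_bracket !par_pos !par_neg opp_pos !eqxx /= eq_lrshift eq_rlshift /=.
by rewrite !mul1r !addr0 !add0r addrK.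
Qed.

Local Notation Fp := (Fpow K N).

Lemma Fpow_neg_pos r k : Fp r (neg k) (pos k) = (-1) ^+ r * Fp r (pos k) (neg k).
Proof. by rewrite -Fpow_opp opp_pos opp_neg. Qed.

Lemma Fpow_neg_neg r k : Fp r (neg k) (neg k) = (-1) ^+ r * Fp r (pos k) (pos k).
Proof. by rewrite -Fpow_opp opp_pos. Qed.

Lemma FpowS r (a b : 'I_(N + N)) : Fp r.+1 a b
  = \sum_(k < N) (F a (pos k) * Fp r (pos k) b - F a (neg k) * Fp r (neg k) b).
Proof.
rewrite [Fp r.+1]/(Fsgn K N *m Fp r) mxE big_split_ord /= -big_split /=.
apply: eq_bigr => k _; rewrite !mxE -!/(pos _) -!/(neg _) par_pos par_neg mul1r.
by rewrite expr1 mulN1r mulNr.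
Qed.

(* In row i of the product, the terms with |m| < |i| start with an element of
   n_-, and those with |m| > |i| become, up to U n_+, the supercommutator c k
   of their factors. *)
Lemma ker_FpowS r i (l : 'I_(N + N)) (c : 'I_N -> U) :
  (forall k : 'I_N, (i < k)%N ->
    ker (F (pos i) (pos k) * Fp r (pos k) l
         - F (pos i) (neg k) * Fp r (neg k) l - c k)) ->
  ker (Fp r.+1 (pos i) l
       - (F (pos i) (pos i) * Fp r (pos i) l
          - F (pos i) (neg i) * Fp r (neg i) l + \sum_(k < N | (i < k)%N) c k)).
Proof.
move=> hc; rewrite FpowS.
rewrite (bigD1 i) //= opprD addrACA subrr add0r.
rewrite (bigID (fun k : 'I_N => i < k)%N) /= addrAC.
apply: HC_kernelD.
  rewrite (eq_bigl (fun k : 'I_N => i < k)%N) -?sumrB; last first.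
    by move=> k; rewrite andbC -(inj_eq val_inj) neq_ltn orbC; case: ltngtP.
  by apply: ker_sum.
apply: ker_sum => k /andP[ki]; rewrite -leqNgt => le.
have lt : (k < i)%N by rewrite ltn_neqAle le (inj_eq val_inj) ki.
by apply: kerB; apply: ker_minus; rewrite ?abs_neg !abs_pos.
Qed.

(** Write A = M^r. For k > i the two supercommutators are A_ii - A_kk and A_ii - A_{-k,-k}. Their
    difference is ((-1)^r - 1) A_kk, whence the multiplicity [(odd r).*2]. *)
Lemma ker_FpowS_diag r i :
  ker (Fp r.+1 (pos i) (pos i)
    - (F (pos i) (pos i) * Fp r (pos i) (pos i)
       - (-1) ^+ r * (F (pos i) (neg i) * Fp r (pos i) (neg i))
       - (\sum_(k < N | (i < k)%N) Fp r (pos k) (pos k)) *+ (odd r).*2)).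
Proof.
rewrite -sumrMnl -sumrN.
have -> : (-1) ^+ r * (F (pos i) (neg i) * Fp r (pos i) (neg i))
    = F (pos i) (neg i) * Fp r (neg i) (pos i).
  by rewrite Fpow_neg_pos !mulrA commr_sign.
apply: ker_FpowS => k ik.
rewrite !(@equivariant_Fpow K N r).
rewrite !par_pos !par_neg !opp_pos !opp_neg !eqxx !eq_rlshift !eq_lrshift /=.
rewrite Fpow_neg_neg !mulr0n !addr0 !mulr1n !mul1r sub_add_common -addrA.
apply: HC_kernelD; first by apply: kerB; rewrite ?expr1 ?mulN1r; [|apply: kerN];
  apply: ker_plus; rewrite ?abs_neg !abs_pos.
rewrite opprK -signr_odd mulr_sign; case: odd => /=.
  by rewrite -opprD -mulr2n addNr; apply: HC_kernel0.
by rewrite subrr add0r; apply: HC_kernel0.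
Qed.

(** Here the difference of the supercommutators is -(1 + (-1)^r) A_{k,-k}, so that even r
    contribute. *)
Lemma ker_FpowS_odd r i :
  ker (Fp r.+1 (pos i) (neg i)
    - (F (pos i) (pos i) * Fp r (pos i) (neg i)
       - (-1) ^+ r * (F (pos i) (neg i) * Fp r (pos i) (pos i))
       - (\sum_(k < N | (i < k)%N) Fp r (pos k) (neg k)) *+ (~~ odd r).*2)).
Proof.
rewrite -sumrMnl -sumrN.
have -> : (-1) ^+ r * (F (pos i) (neg i) * Fp r (pos i) (pos i))
    = F (pos i) (neg i) * Fp r (neg i) (neg i).
  by rewrite Fpow_neg_neg !mulrA commr_sign.
apply: ker_FpowS => k ik.
rewrite !(@equivariant_Fpow K N r).
rewrite !par_pos !par_neg !opp_pos !opp_neg !eqxx !eq_rlshift !eq_lrshift /=.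
rewrite Fpow_neg_pos !mulr0n !addr0 !add0r !mulr1n !mul1r sub_add_common -addrA.
apply: HC_kernelD; first by apply: kerB; apply: ker_plus;
  rewrite ?abs_neg !abs_pos.
rewrite opprK expr1 mulN1r -signr_odd mulr_sign; case: odd => /=.
  by rewrite opprK subrr add0r; apply: HC_kernel0.
by rewrite -opprD -mulr2n addNr; apply: HC_kernel0.
Qed.

Local Notation hw := (diag_eig (fun i => 'X_i) (@xlam K N)).

(** The recursion couples the entries (i, i) and (i, -i), so both are followed through two
    multiplications by M at a time. *)
Lemma ker_Fpow_even s i :
  ker (Fp s.*2 (pos i) (pos i) - at_ (hw s i)) /\ ker (Fp s.*2 (pos i) (neg i)).
Proof.
elim: s i => [|s IH] i.
  rewrite at_1 !mxE eqxx subrr eq_lrshift; split; exact: HC_kernel0.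
have ker_l a b z : abs_idx a = abs_idx b -> ker z -> ker (F a b * z).
  exact: kerMl.
(* The intermediate power M^(2s+1): with u = [hw s], its (k, k) entry is lam_k u_k and its (k, -k)
   entry is -F_{k,-k} u_k. *)
have kX k : ker (Fp s.*2.+1 (pos k) (pos k) - at_ ('X_k * hw s k)).
  have [k1 k2] := IH k; apply: ker_trans (ker_FpowS_diag s.*2 k) _.
  rewrite odd_double mulr0n subr0 -signr_odd odd_double mul1r addrAC.
  by apply: kerB; [exact: ker_Fdiag_at|apply: ker_l; rewrite ?abs_pos ?abs_neg].
have kO k : ker (Fp s.*2.+1 (pos k) (neg k) + F (pos k) (neg k) * at_ (hw s k)).
  rewrite -[F _ _ * at_ _]opprK.
  have [k1 k2] := IH k; apply: ker_trans (ker_FpowS_odd s.*2 k) _.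
  rewrite -signr_odd odd_double mul1r opprK addrAC; apply: kerB.
    rewrite -addrA -[_ * at_ _]opprK -opprD -mulrBr; apply: kerB.
      by apply: ker_l; rewrite ?abs_pos ?abs_neg.
    by apply: ker_l; rewrite ?abs_pos ?abs_neg.
  by apply: kerMn; apply: ker_sum => l _; case: (IH l).
rewrite doubleS; split.
  apply: ker_trans (ker_FpowS_diag s.*2.+1 i) _.
  rewrite /= at_B at_Mn at_sum -signr_odd /= odd_double /= expr1 mulN1r opprK.
  rewrite opprB [_ *+ 2 - _]addrC addrACA [- _ + _]addrC -mulrnBl -sumrB.
  apply: HC_kernelD; last first.
    by apply: kerMn; apply: ker_sum => k _; rewrite -opprB; apply: kerN.
  (* By [F_odd_sqr], lam_i^2 - F_{i,-i}^2 = lam_i^2 - lam_i = x_i. *)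
  have -> : at_ (xlam K i * hw s i)
      = F (pos i) (pos i) * at_ ('X_i * hw s i)
        + - (F (pos i) (neg i) * (F (pos i) (neg i) * at_ (hw s i))).
    rewrite mulrA F_odd_sqr /xlam -mulrA mulrBl mul1r mulrBr at_B.
    by rewrite !(at_M, at_X).
  rewrite opprD opprK addrACA -mulrBr -mulrDr; apply: HC_kernelD.
    exact: ker_l.
  by apply: ker_l; rewrite ?abs_pos ?abs_neg.
have := ker_FpowS_odd s.*2.+1 i.
rewrite -signr_odd /= odd_double /= expr1 mulN1r opprK subr0 => h.
rewrite -[X in ker X]subr0; apply: ker_trans h _; rewrite subr0.
(* The two leading terms cancel because F_ii commutes with F_{i,-i}. *)
have -> : F (pos i) (pos i) * Fp s.*2.+1 (pos i) (neg i)
      + F (pos i) (neg i) * Fp s.*2.+1 (pos i) (pos i)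
   = F (pos i) (pos i) * (Fp s.*2.+1 (pos i) (neg i) + F (pos i) (neg i) * at_ (hw s i))
   + F (pos i) (neg i) * (Fp s.*2.+1 (pos i) (pos i) - at_ ('X_i * hw s i)).
  rewrite mulrDr mulrBr at_M at_X !mulrA F_odd_comm.
  by rewrite addrACA subrr addr0.
by apply: HC_kernelD; apply: ker_l; rewrite ?abs_pos ?abs_neg.
Qed.

Lemma cyclic_diag r : (0 < r)%N ->
  cyclic K N r = \sum_k (Fp r (pos k) (pos k) - Fp r (neg k) (neg k)).
Proof.
move=> r0; rewrite cyclicE // big_split_ord /= -big_split; apply: eq_bigr => k _.
by rewrite -!/(pos _) -!/(neg _) par_pos par_neg mul1r expr1 mulN1r.
Qed.

(** In the odd power 2s+1 the entries at -k and k are opposite, so the two halves of the supertrace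
    agree; hence the factor 2. *)
Lemma ker_odd_cyclic s :
  ker (odd_cyclic K N s.+1 - at_ ((\sum_k 'X_k * hw s k) *+ 2)).
Proof.
rewrite /odd_cyclic doubleS -pred_Sn cyclic_diag //.
rewrite at_Mn at_sum -sumrMnl -sumrB; apply: ker_sum => k _.
rewrite Fpow_neg_neg -signr_odd oddS odd_double mulN1r opprK -mulr2n -mulrnBl.
apply: kerMn.
apply: ker_trans (ker_FpowS_diag s.*2 k) _.
rewrite odd_double mulr0n subr0 -signr_odd odd_double mul1r addrAC.
have [k1 k2] := ker_Fpow_even s k; apply: kerB; first exact: ker_Fdiag_at.
by apply: kerMl; rewrite ?abs_pos ?abs_neg.
Qed.

Lemma ker_Delta : ker (Delta K N
  - at_ (\det (\matrix_(i < N, j < N) ((\sum_k 'X_k * hw (i + j) k) *+ 2)))).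
Proof.
apply: ker_det => [a b u|a b]; rewrite !mxE.
  by apply: cyclic_comm => //; apply: odd_cyclic_gt0.
exact: ker_odd_cyclic.
Qed.

End HarishChandra.

(** * The oscillator representation of gl(N|N) *)

Section Oscillators.
Variables (B : comNzRingType) (V : lmodType B) (J : finType) (p : J -> bool).
Variables ap am : J -> {linear V -> V}.
Implicit Types (x y z t : J) (f : V).

Hypothesis apC : forall x y f, ap x (ap y f) = (-1) ^+ (p x && p y) *: ap y (ap x f).
Hypothesis amC : forall x y f, am x (am y f) = (-1) ^+ (p x && p y) *: am y (am x f).
Hypothesis am_ap : forall x y f,
  am x (ap y f) = (-1) ^+ (p x && p y) *: ap y (am x f) + f *+ (x == y).

(** Normal ordering of both sides gives the same quartic term up to sign; the contractions y = z and
    x = t remain. This is the bracket of matrix units in gl(N|N). *)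
Lemma quad_comm x y z t f :
  ap x (am y (ap z (am t f))) =
    (-1) ^+ ((p x (+) p y) && (p z (+) p t)) *: ap z (am t (ap x (am y f)))
    + ap x (am t f) *+ (y == z)
    - (-1) ^+ ((p x (+) p y) && (p z (+) p t)) *: ap z (am y f) *+ (x == t).
Proof.
rewrite am_ap [am t (ap x _)]am_ap (linearD (ap x)) (linearD (ap z)).
rewrite (linearMn (ap x)) (linearMn (ap z)) !linearZ /= scalerDr scalerA.
rewrite -scalerMnr [t == x]eq_sym [X in _ = X - _]addrAC addrK.
congr (_ + _); rewrite apC (amC y) !linearZ /= !scalerA.
congr (_ *: _); rewrite -!signr_addb; congr (_ ^+ nat_of_bool _).
by case: (p x) (p y) (p z) (p t) => [] [] [] [].
Qed.

End Oscillators.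

Section OscillatorRep.
Variables (K : fieldType) (N : nat) (B : comNzRingType) (iota : {rmorphism K -> B}).
Variables (V : lmodType B) (C : finType).
Local Notation I := 'I_(N + N).
Variables ap am : I * C -> {linear V -> V}.
Let p (x : I * C) := par x.1.
Hypothesis apC : forall x y f, ap x (ap y f) = (-1) ^+ (p x && p y) *: ap y (ap x f).
Hypothesis amC : forall x y f, am x (am y f) = (-1) ^+ (p x && p y) *: am y (am x f).
Hypothesis am_ap : forall x y f,
  am x (ap y f) = (-1) ^+ (p x && p y) *: ap y (am x f) + f *+ (x == y).
Implicit Types (i j k l : I) (f : V) (X Y : 'M[K]_(N + N)).

Definition osc i j f := \sum_c ap (i, c) (am (j, c) f).

Lemma osc_linear i j : linear (osc i j).
Proof.
move=> a f g; rewrite scaler_sumr -big_split; apply: eq_bigr => c _.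
by rewrite !linearP.
Qed.
HB.instance Definition _ i j :=
  GRing.isLinear.Build B V V *:%R (osc i j) (osc_linear i j).

Lemma osc_comm i j k l f :
  osc i j (osc k l f) =
    (-1) ^+ ((par i (+) par j) && (par k (+) par l)) *: osc k l (osc i j f)
    + osc i l f *+ (j == k)
    - (-1) ^+ ((par i (+) par j) && (par k (+) par l)) *: osc k j f *+ (i == l).
Proof.
set s := (-1) ^+ _.
have -> : osc i j (osc k l f) =
    \sum_c \sum_d ap (i, c) (am (j, c) (ap (k, d) (am (l, d) f))).
  by apply: eq_bigr => c _; rewrite !linear_sum.
have -> : osc k l (osc i j f) =
    \sum_c \sum_d ap (k, d) (am (l, d) (ap (i, c) (am (j, c) f))).
  by rewrite exchange_big; apply: eq_bigr => c _; rewrite !linear_sum.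
(* Modes contract only if their colours agree, so a sum over one colour is rewritten as a double sum
   and [quad_comm] is applied termwise. *)
have delta (g : C -> C -> V) (b : bool) :
    (\sum_c g c c) *+ b = \sum_c \sum_d g c d *+ (b && (c == d)).
  rewrite -sumrMnl; apply: eq_bigr => c _.
  rewrite (bigD1 c) //= eqxx andbT big1 ?addr0 // => d /negPf.
  by rewrite eq_sym => ->; rewrite andbF.
rewrite /osc (delta (fun c d => ap (i, c) (am (l, d) f))) !scaler_sumr.
rewrite (delta (fun c d => s *: ap (k, d) (am (j, c) f))).
rewrite -!sumrN -!big_split /=; apply: eq_bigr => c _.
rewrite scaler_sumr -!sumrN -!big_split /=; apply: eq_bigr => d _.
by rewrite (quad_comm apC amC am_ap).
Qed.

Definition osc_mx X f := \sum_e iota (X e.1 e.2) *: osc e.1 e.2 f.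

Lemma osc_mx_linear X : linear (osc_mx X).
Proof.
move=> a f g; rewrite scaler_sumr -big_split; apply: eq_bigr => c _ /=.
by rewrite linearP scalerDr !scalerA mulrC.
Qed.
HB.instance Definition _ X :=
  GRing.isLinear.Build B V V *:%R (osc_mx X) (osc_mx_linear X).

Lemma osc_mx_lin a X Y f : osc_mx (a *: X + Y) f = iota a *: osc_mx X f + osc_mx Y f.
Proof.
rewrite scaler_sumr -big_split; apply: eq_bigr => e _ /=.
by rewrite !mxE rmorphD rmorphM scalerDl scalerA.
Qed.

Lemma osc_mxM X Y f : osc_mx (X *m Y) f = \sum_e \sum_g
  (iota (X e.1 e.2) * iota (Y g.1 g.2)) *: (osc e.1 g.2 f *+ (e.2 == g.1)).
Proof.
rewrite /osc_mx -(pair_bigA _ (fun i l => iota ((X *m Y) i l) *: osc i l f)) /=.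
rewrite -(pair_bigA _ (fun i j => \sum_g
  (iota (X i j) * iota (Y g.1 g.2)) *: (osc i g.2 f *+ (j == g.1)))) /=.
apply: eq_bigr => i _; under [RHS]eq_bigr => j _.
  rewrite -(pair_bigA _ (fun k l =>
    (iota (X i j) * iota (Y k l)) *: (osc i l f *+ (j == k)))) exchange_big /=.
  over.
rewrite exchange_big; apply: eq_bigr => l _ /=.
rewrite mxE rmorph_sum scaler_suml; apply: eq_bigr => j _.
by under eq_bigr => k _ do rewrite -scalerMnr; rewrite sum_mulr_delta rmorphM.
Qed.

Lemma osc_mx_bracket a b X Y f : mx_homog a X -> mx_homog b Y ->
  osc_mx X (osc_mx Y f)
  = (-1) ^+ (a && b) *: osc_mx Y (osc_mx X f) + osc_mx (sbracket a b X Y) f.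
Proof.
move=> hX hY.
have -> : sbracket a b X Y = (- (-1) ^+ (a && b)) *: (Y *m X) + X *m Y.
  by rewrite scaleNr addrC.
rewrite osc_mx_lin !osc_mxM rmorphN rmorph_sign scaleNr.
rewrite [X in - (_ *: X)]exchange_big /=.
have -> : osc_mx X (osc_mx Y f) = \sum_e \sum_g
    (iota (X e.1 e.2) * iota (Y g.1 g.2)) *: osc e.1 e.2 (osc g.1 g.2 f).
  apply: eq_bigr => e _; rewrite [osc_mx Y f]/osc_mx (linear_sum (osc _ _)) scaler_sumr.
  by apply: eq_bigr => g _; rewrite linearZ scalerA.
have -> : osc_mx Y (osc_mx X f) = \sum_e \sum_g
    (iota (X e.1 e.2) * iota (Y g.1 g.2)) *: osc g.1 g.2 (osc e.1 e.2 f).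
  rewrite exchange_big.
  apply: eq_bigr => e _; rewrite [osc_mx X f]/osc_mx (linear_sum (osc _ _)) scaler_sumr.
  by apply: eq_bigr => g _; rewrite linearZ scalerA mulrC.
rewrite !scaler_sumr -!sumrN -!big_split; apply: eq_bigr => e _ /=.
rewrite !scaler_sumr -!sumrN -!big_split; apply: eq_bigr => g _ /=.
(* Homogeneity fixes the parity of a position only where the entry is nonzero. *)
have [->|X0] := eqVneq (X e.1 e.2) 0.
  by rewrite rmorph0 mulr0 !mul0r !scale0r !scaler0 oppr0 !addr0.
have [->|Y0] := eqVneq (Y g.1 g.2) 0.
  by rewrite rmorph0 mulr0 !mul0r !scale0r !scaler0 oppr0 !addr0.
rewrite osc_comm (hX _ _ X0) (hY _ _ Y0) scalerBr scalerDr !scalerA.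
rewrite [(-1) ^+ _ * _]mulrC -addrA; congr (_ + _); rewrite addrC; congr (_ + _).
rewrite [g.2 == e.1]eq_sym; congr (- _).
by rewrite !scalerMnr scalerA; congr (_ *: _); rewrite mulrC [iota _ * iota _]mulrC.
Qed.

Fixpoint osc_expr (s : expr (qN K N)) (f : V) : V :=
  match s with
  | Gen x => osc_mx (vsval x) f
  | Sca a => iota a *: f
  | Add s t => osc_expr s f + osc_expr t f
  | Mul s t => osc_expr s (osc_expr t f)
  end.

Lemma osc_expr_linear s : linear (osc_expr s).
Proof.
elim: s => [x|a|s IHs t IHt|s IHs t IHt] c f g /=.
- by rewrite linearP.
- by rewrite scalerDr !scalerA mulrC.
- by rewrite IHs IHt scalerDr addrACA.
by rewrite IHt IHs.
Qed.
HB.instance Definition _ s :=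
  GRing.isLinear.Build B V V *:%R (osc_expr s) (osc_expr_linear s).

Lemma osc_expr_cong s t : cong s t -> osc_expr s =1 osc_expr t.
Proof.
elim=> {s t} /=.
- by [].
- by move=> s t _ IH f; rewrite IH.
- by move=> s t u _ IH1 _ IH2 f; rewrite IH1 IH2.
- by move=> s s' t t' _ IH1 _ IH2 f; rewrite IH1 IH2.
- by move=> s s' t t' _ IH1 _ IH2 f; rewrite IH1 IH2.
- by move=> s t u f; rewrite addrA.
- by move=> s t f; rewrite addrC.
- by move=> s f; rewrite rmorph0 scale0r add0r.
- by move=> s f; rewrite rmorphN rmorph1 rmorph0 scaleN1r scale0r addNr.
- by [].
- by [].
- by move=> s t u f; rewrite linearD.
- by move=> s f; rewrite rmorph1 scale1r.
- by move=> a b f; rewrite rmorphD scalerDl.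
- by move=> a b f; rewrite rmorphM scalerA.
- by move=> a s f; rewrite linearZ.
- by move=> a x y f; rewrite -osc_mx_lin.
move=> a b x y z hx hy hz f; rewrite (osc_mx_bracket _ hx hy) hz.
by rewrite rmorphN rmorph_sign scaleNr addrAC subrr add0r.
Qed.

Definition osc_act (u : U (qN K N)) (f : V) : V := osc_expr (repr u) f.

Lemma osc_act_cls s f : osc_act (cls s) f = osc_expr s f.
Proof. exact/osc_expr_cong/repr_cls. Qed.

Lemma osc_act_linear u : linear (osc_act u).
Proof. exact: osc_expr_linear. Qed.
HB.instance Definition _ u :=
  GRing.isLinear.Build B V V *:%R (osc_act u) (osc_act_linear u).

Lemma osc_actD u v f : osc_act (u + v) f = osc_act u f + osc_act v f.
Proof.
elim/clsP: u => s; elim/clsP: v => t.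
by rewrite [cls s + cls t]U_addE !osc_act_cls.
Qed.

Lemma osc_actM u v f : osc_act (u * v) f = osc_act u (osc_act v f).
Proof.
elim/clsP: u => s; elim/clsP: v => t.
by rewrite [cls s * cls t]U_mulE !osc_act_cls.
Qed.

Lemma osc_act1 f : osc_act 1 f = f.
Proof. by rewrite osc_act_cls /= rmorph1 scale1r. Qed.

Lemma osc_actZ a u f : osc_act (a *: u) f = iota a *: osc_act u f.
Proof. by elim/clsP: u => s; rewrite [a *: cls s]U_mulE !osc_act_cls. Qed.

Lemma osc_act0 f : osc_act 0 f = 0.
Proof. by rewrite -[0](scale0r 1) osc_actZ rmorph0 scale0r. Qed.

Lemma osc_actF i j f :
  osc_act (F K i j) f = osc i j f + osc (opp_idx i) (opp_idx j) f.
Proof.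
have delta a b : osc_mx (delta_mx a b) f = osc a b f.
  rewrite /osc_mx (bigD1 (a, b)) //= mxE !eqxx rmorph1 scale1r big1 ?addr0 //.
  case=> a' b' /negPf; rewrite xpair_eqE => ne /=.
  by rewrite mxE ne rmorph0 scale0r.
rewrite osc_act_cls /= -[Fmx _ _ _]/(delta_mx _ _ + _).
by rewrite -[delta_mx i j]scale1r osc_mx_lin rmorph1 scale1r !delta.
Qed.

End OscillatorRep.

Definition oddz (k : int) : bool := odd `|k|%N.

Lemma oddzD k l : oddz (k + l) = oddz k (+) oddz l.
Proof.
have oddzE (a b : nat) : oddz (a%:Z - b%:Z) = odd a (+) odd b.
  have [le|/ltnW le] := leqP b a; rewrite /oddz.
    by rewrite subzn // oddB.
  by rewrite distnC subzn // oddB // addbC.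
have [a [b ->]] : exists a b : nat, k = a%:Z - b%:Z.
  by case: (intP k) => [|m|m];
    [exists 0%N, 0%N|exists m.+1, 0%N|exists 0%N, m.+1]; rewrite ?subr0 ?sub0r.
have [c [d ->]] : exists a b : nat, l = a%:Z - b%:Z.
  by case: (intP l) => [|m|m];
    [exists 0%N, 0%N|exists m.+1, 0%N|exists 0%N, m.+1]; rewrite ?subr0 ?sub0r.
by rewrite addrACA -opprD -!PoszD !oddzE !oddD addbACA.
Qed.

(** * Fock space and uniqueness of the Harish-Chandra image *)

Section Fock.
Variables (K : fieldType) (N : nat).
Local Notation B := {mpoly K[N]}.
Local Notation mode := ('I_(N + N) * 'I_N)%type.
Local Notation state := {ffun mode -> int}.
Local Notation V := (state -> B^o).
Implicit Types (m : mode) (n : state) (e : bool) (f g : V).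

(** A vector is a function of occupation numbers, and an operator acts by reading it at a shifted
    state. Annihilation therefore reads at n + 1 and creation at n - 1. *)
Definition shift_by e m : state :=
  [ffun j => if j == m then (if e then 1 else -1) else 0].

(* In colour c the boson pos c stands for a variable t acting on powers
   t^(X_c + k) with k in Z: this is what makes the weight of vac generic. *)
Definition special m := m.1 == pos m.2.

(* Coefficients of creation (e = false) and annihilation (e = true) at the
   occupation number k, a signed integer.  For an ordinary mode, creation is
   cut from -1 to 0 and annihilation from 0 to -1, so that the occupation
   number 0 is a vacuum; a fermion only sees the parity of k. *)
Definition coef e m (k : int) : B :=
  if par m.1 then (oddz k (+) e)%:R
  else if special m then (if e then k%:~R + 1 + 'X_m.2 else 1)
  else (if e then k%:~R + 1 else (k != 0)%:R).

(* Jordan-Wigner signs. *)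
Definition jw m n : bool := par m.1
  && oddz (\sum_(j | par j.1 && (enum_rank j < enum_rank m)%N) n j).

Definition ladder e m f : V :=
  fun n => coef e m (n m) * (-1) ^+ jw m n * f (n + shift_by e m).

Lemma ladder_linear e m : linear (ladder e m).
Proof.
move=> a f g; apply/funext => n; rewrite /ladder /=.
rewrite -[(_ + _) (n + _)]/(a * f _ + g _) -[RHS]/(a * _ + _) mulrDr.
by congr (_ + _); rewrite mulrCA.
Qed.
HB.instance Definition _ e m :=
  GRing.isLinear.Build B V V *:%R (ladder e m) (ladder_linear e m).

Lemma oddz_shift e m m' : oddz (shift_by e m m') = (m' == m).
Proof. by rewrite ffunE; case: (m' == m) => //; case: e. Qed.

Lemma jw_shift e m m' n :
  jw m' (n + shift_by e m)
  = jw m' n (+) (par m.1 && par m'.1 && (enum_rank m < enum_rank m')%N).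
Proof.
rewrite /jw; case: (par m'.1); last by rewrite andbF.
rewrite andbT !andTb.
under eq_bigr => j _ do rewrite ffunE.
rewrite big_split oddzD /=; congr (_ (+) _).
have [in_m|out_m] := boolP (par m.1 && _).
  rewrite (bigD1 m) //= big1 ?addr0 ?oddz_shift ?eqxx //.
  by move=> j /andP[_ /negPf ne]; rewrite ffunE ne.
rewrite big1 // => j hj; rewrite ffunE; case: eqP => // jm.
by rewrite -jm hj in out_m.
Qed.

(** Of two distinct fermionic modes exactly one precedes the other, so exactly one Jordan-Wigner
    sign flips on exchange. *)
Lemma ladder_neq e e' m m' f : m != m' ->
  ladder e m (ladder e' m' f)
  = (-1) ^+ (par m.1 && par m'.1) *: ladder e' m' (ladder e m f).
Proof.
move=> ne; apply/funext => n; rewrite -[RHS]/(_ * _) /ladder !jw_shift.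
rewrite !ffunE (negPf ne) eq_sym (negPf ne) !addr0 addrAC.
have sgn : (-1) ^+ jw m n * (-1) ^+ (jw m' n (+)
     (par m.1 && par m'.1 && (enum_rank m < enum_rank m')%N)) =
   (-1) ^+ (par m.1 && par m'.1) * ((-1) ^+ jw m' n * (-1) ^+ (jw m n (+)
     (par m'.1 && par m.1 && (enum_rank m' < enum_rank m)%N))) :> B.
  rewrite -!signr_addb; congr (_ ^+ nat_of_bool _).
  have := inj_eq (@enum_rank_inj _) m m'; rewrite (negPf ne) -(inj_eq val_inj) /=.
  case: (jw m n) (jw m' n) (par m.1) (par m'.1) => [] [] [] [] //=;
  by case: ltngtP.
set f' := f _; set c := coef e m _; set c' := coef e' m' _.
transitivity ((-1) ^+ jw m n * (-1) ^+ (jw m' n (+)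
     (par m.1 && par m'.1 && (enum_rank m < enum_rank m')%N)) * (c * c' * f')).
  by ring.
by rewrite sgn; ring.
Qed.

Lemma ladder_sqr e m f : par m.1 -> ladder e m (ladder e m f) = 0.
Proof.
move=> pm; apply/funext => n; rewrite /ladder /coef pm ffunE oddzD oddz_shift eqxx.
rewrite -[0 n]/(0 : B).
case: (oddz (n m)) e => [] []; rewrite ?mul0r ?mulr0 // ?mul0r ?mulr0.
Qed.

(** The canonical (anti)commutation relation at one occupation number. For ordinary bosons the cut
    is harmless: each indicator multiplies the very number that it tests against 0. *)
Lemma coef_shift_comm m k : coef true m k * coef false m (k + 1)
  = (-1) ^+ par m.1 * (coef false m k * coef true m (k - 1)) + 1.
Proof.
rewrite /coef; case: (par m.1).
  by rewrite !oddzD; case: (oddz k); rewrite /= ?mul0r ?mulr0 ?mulr1 ?addr0 ?add0r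
    ?expr1 ?mulN1r ?oppr0 ?addNr ?add0r.
rewrite mul1r; case: (special m).
  by rewrite mulr1 mul1r rmorphB rmorph1 subrK addrAC.
have [->|k0] := eqVneq k 0; first by rewrite mulr0z !add0r mul0r add0r mulr1.
rewrite mul1r rmorphB rmorph1 subrK.
have -> : k%:~R + 1 = (k + 1)%:~R :> B by rewrite rmorphD rmorph1.
by have [->|k1] := eqVneq (k + 1) 0; rewrite ?mulr1 // mulr0z mul0r.
Qed.

Lemma ladder_comm m f : ladder true m (ladder false m f)
  = (-1) ^+ par m.1 *: ladder false m (ladder true m f) + f.
Proof.
apply/funext => n; rewrite -[RHS]/(_ * _ + _) /ladder !jw_shift ltnn andbF addbF.
have shiftK e : n + shift_by e m + shift_by (~~ e) m = n.
  apply/ffunP => j; rewrite !ffunE; case: eqP => _; rewrite ?addr0 //.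
  by case: e; rewrite ?addrK ?subrK.
rewrite (shiftK true) (shiftK false) !ffunE eqxx.
set s := _ ^+ jw m n; have ss : s * s = 1 by rewrite -signr_addb addbb.
rewrite mulrA mulrACA ss mulr1 coef_shift_comm mulrDl mul1r; congr (_ + _).
by rewrite -[LHS]mulr1 -ss; ring.
Qed.

(* In colour c the modes i with |i| < c have creation and annihilation
   exchanged; with this choice n_+ kills vac and n_- never reaches ground. *)
Definition swapped m := (abs_idx m.1 < m.2)%N.

(** Exchanging creation and annihilation negates the commutator of a boson and preserves the
    anticommutator of a fermion; this sign compensates. *)
Definition amsgn m : B := (-1) ^+ (swapped m && ~~ par m.1).

Definition aplus m : V -> V := ladder (swapped m) m.
HB.instance Definition _ m := GRing.Linear.on (aplus m).

Definition aminus m (f : V) : V := amsgn m *: ladder (~~ swapped m) m f.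

Lemma aminus_linear m : linear (aminus m).
Proof. by move=> a f g; rewrite /aminus linearP scalerDr !scalerA [_ * a]mulrC. Qed.
HB.instance Definition _ m :=
  GRing.isLinear.Build B V V *:%R (aminus m) (aminus_linear m).

Lemma aplusC m m' f :
  aplus m (aplus m' f) = (-1) ^+ (par m.1 && par m'.1) *: aplus m' (aplus m f).
Proof.
have [->|ne] := eqVneq m m'; last exact: ladder_neq.
case: (boolP (par m'.1)) => [pm|_]; last by rewrite scale1r.
by rewrite /aplus ladder_sqr // scaler0.
Qed.

Lemma aminusC m m' f :
  aminus m (aminus m' f) = (-1) ^+ (par m.1 && par m'.1) *: aminus m' (aminus m f).
Proof.
have [->|ne] := eqVneq m m'.
  case: (boolP (par m'.1)) => [pm|_]; last by rewrite scale1r.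
  by rewrite /aminus linearZ /= ladder_sqr // !scaler0.
rewrite /aminus !linearZ /= ladder_neq // !scalerA.
Qed.

Lemma aminus_aplus m m' f : aminus m (aplus m' f)
  = (-1) ^+ (par m.1 && par m'.1) *: aplus m' (aminus m f) + f *+ (m == m').
Proof.
have [->|ne] := eqVneq m m'; last first.
  by rewrite addr0 /aminus linearZ /= ladder_neq // !scalerA mulrC.
rewrite /aminus /aplus /amsgn linearZ /=; case: (swapped m') => /=; last first.
  by rewrite !scale1r ladder_comm andbb.
rewrite ladder_comm andbb; case: (par m'.1); rewrite /= ?expr1 ?expr0 ?scale1r.
  by rewrite !scaleN1r opprD opprK addrNK.
by rewrite !scaleN1r opprD addrNK.
Qed.

Definition ground : state := [ffun => 0].

Definition vac : V := fun n => (n == ground)%:R.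

Lemma ladder_vac m : ~~ special m -> ladder true m vac = 0.
Proof.
move=> /negPf nsp; apply/funext => n; rewrite /ladder /vac -[0 n]/(0 : B).
case: eqP => [/ffunP/(_ m)|_]; last by rewrite mulr0.
(* Only occupation number -1 could contribute, and there the annihilation coefficient is 0 for
   bosons and fermions alike. *)
rewrite !ffunE eqxx => /eqP; rewrite addr_eq0 => /eqP ->.
by rewrite /coef nsp; case: (par _); rewrite ?rmorphN ?rmorph1 ?addNr ?mul0r.
Qed.

Lemma ladder_eval0 m f : ~~ special m -> ladder false m f ground = 0.
Proof.
move=> /negPf nsp; rewrite /ladder ffunE /coef nsp.
by case: (par _); rewrite !mul0r.
Qed.

Lemma ladder_special m : special m ->
  ladder false m (ladder true m vac) = 'X_m.2 *: vac.
Proof.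
move=> sp; apply/funext => n; rewrite -[RHS]/(_ * _) /ladder /jw /coef.
have /eqP -> := sp; rewrite par_pos /= sp !expr0 !mulr1 mul1r.
have -> : n + shift_by false m + shift_by true m = n.
  apply/ffunP => j; rewrite !ffunE; case: eqP => _; rewrite ?addr0 //.
  by rewrite subrK.
rewrite ffunE /vac; have [->|_] := eqVneq n ground; last by rewrite !mulr0.
by rewrite ffunE add0r !ffunE eqxx rmorphN rmorph1 addNr add0r.
Qed.

Lemma vac_ground : vac ground = 1. Proof. by rewrite /vac eqxx. Qed.

Local Notation osc := (osc aplus aminus).

Lemma special_abs m : special m -> abs_idx m.1 = m.2.
Proof. by move/eqP->; rewrite abs_pos. Qed.

Lemma not_special m : abs_idx m.1 != m.2 -> ~~ special m.
Proof. by apply: contra => /special_abs/eqP. Qed.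

Lemma aplus_aminus m m' f : m != m' ->
  aplus m (aminus m' f) = (-1) ^+ (par m.1 && par m'.1) *: aminus m' (aplus m f).
Proof.
move=> ne; rewrite aminus_aplus [m' == m]eq_sym (negPf ne) addr0 scalerA.
by rewrite [par m'.1 && _]andbC -signr_addb addbb scale1r.
Qed.

(** In every colour c some factor creates an ordinary quantum: the one of index i if c < |i|,
    otherwise the exchanged one of index j, as |j| < c. Moved to the left, it is killed by
    evaluation at [ground]. [osc_vac] is the dual argument with annihilators moved to the right. *)
Lemma osc_eval0 i j f : (abs_idx j < abs_idx i)%N -> osc i j f ground = 0.
Proof.
move=> ji; rewrite /osc; elim/big_ind: _ => // [g h g0 h0|c _ /=].
  by rewrite -[(g + h) ground]/(g ground + h ground) g0 h0 addr0.
have [ci|ic] := ltnP c (abs_idx i).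
  have sw : swapped (i, c) = false by rewrite /swapped /= ltnNge ltnW.
  rewrite /= /aplus sw; apply: ladder_eval0.
  by apply: not_special; rewrite neq_ltn ci orbT.
have jc := leq_trans ji ic; rewrite aplus_aminus; last first.
  by apply: contraTneq ji => -[->]; rewrite ltnn.
have sw : swapped (j, c) = true by rewrite /swapped.
rewrite /= /aminus sw; set g := ladder _ _ _.
have g0 : g ground = 0.
  by apply: ladder_eval0; apply: not_special; rewrite neq_ltn jc.
rewrite -[LHS]/((-1) ^+ _ * (amsgn _ * g ground)) g0.
by rewrite !mulr0.
Qed.

Lemma osc_vac i j : (abs_idx i < abs_idx j)%N -> osc i j vac = 0.
Proof.
move=> ij; rewrite /osc big1 // => c _ /=.
have [cj|jc] := ltnP c (abs_idx j).
  have sw : swapped (j, c) = false by rewrite /swapped /= ltnNge ltnW.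
  rewrite /= /aminus sw ladder_vac ?scaler0 ?linear0 //.
  by rewrite not_special //= neq_ltn cj orbT.
have ic := leq_trans ij jc; rewrite aplus_aminus; last first.
  by apply: contraTneq ij => -[->]; rewrite ltnn.
have sw : swapped (i, c) = true by rewrite /swapped.
rewrite /= /aplus sw ladder_vac ?linear0 ?scaler0 //.
by rewrite not_special //= neq_ltn ic.
Qed.

(** Colour k gives X_k through its special boson. Colours c < k give 0, and for c > k the exchange
    produces -1 from the boson and +1 from the fermion. *)
Lemma osc_diag_vac (k : 'I_N) :
  osc (pos k) (pos k) vac + osc (neg k) (neg k) vac = 'X_k *: vac.
Proof.
rewrite /osc -big_split (bigD1 k) //= [X in _ + X]big1 => [|c ck].
  rewrite addr0 /aplus /aminus /amsgn /swapped /= abs_pos abs_neg ltnn /=.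
  rewrite !scale1r ladder_special /special /= ?eqxx // ladder_vac ?linear0 ?addr0 //.
  by rewrite /special /= eq_rlshift.
have ns (i : 'I_(N + N)) : abs_idx i = k -> ~~ special (i, c).
  by move=> ik; apply: not_special; rewrite /= ik eq_sym.
rewrite /aplus /aminus /amsgn /swapped /= abs_pos abs_neg par_pos par_neg.
have [kc|ck'] := ltnP k c; last first.
  by rewrite /= !ladder_vac ?linear0 ?addr0 ?ns ?abs_pos ?abs_neg.
rewrite /= expr0 expr1 scaleN1r scale1r linearN /= !ladder_comm.
rewrite !ladder_vac ?ns ?abs_pos ?abs_neg // !linear0 ?scaler0 !add0r.
by rewrite addNr.
Qed.

Local Notation act := (osc_act (@mpolyC N K) aplus aminus).

Lemma act_Fdiag_vac (k : 'I_N) : act (F K (pos k) (pos k)) vac = 'X_k *: vac.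
Proof.
by rewrite (osc_actF (@mpolyC N K) aplusC aminusC aminus_aplus) opp_pos osc_diag_vac.
Qed.

Let actD := osc_actD (@mpolyC N K) aplusC aminusC aminus_aplus.
Let actM := osc_actM (@mpolyC N K) aplusC aminusC aminus_aplus.

Lemma act_at_vac p : act (at_Fii p) vac = p *: vac.
Proof.
rewrite [X in at_Fii X](mpolyE p) [X in _ = X *: _](mpolyE p) at_sum.
rewrite (big_morph (fun u => act u vac) (fun u v => actD u v _)
  (osc_act0 (@mpolyC N K) aplusC aminusC aminus_aplus vac)) scaler_suml.
apply: eq_bigr => m _; rewrite at_Z (osc_actZ (@mpolyC N K) aplusC aminusC aminus_aplus).
rewrite -mul_mpolyC -scalerA; congr (_ *: _).
rewrite at_FiiE mmapX -mmap1_id /mmap1.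
elim/big_ind2: _ => [|q u q' u' hu hu'|i _].
- by rewrite (osc_act1 (@mpolyC N K) aplusC aminusC aminus_aplus) scale1r.
- by rewrite actM hu' linearZ /= hu !scalerA mulrC.
elim: (m i) => [|k IH].
  by rewrite (osc_act1 (@mpolyC N K) aplusC aminusC aminus_aplus) scale1r.
by rewrite !exprS actM IH linearZ /= act_Fdiag_vac !scalerA mulrC.
Qed.

Lemma ker_eval0 z : 2%:R != 0 :> K -> HC_kernel z -> act z vac ground = 0.
Proof.
move=> char2; elim/(@ker_ind K N char2): z / => [|u v hu hv|i j u ji|i j u ij].
- by rewrite (osc_act0 (@mpolyC N K) aplusC aminusC aminus_aplus).
- rewrite actD -[LHS]/(act u vac ground + act v vac ground) hu hv.
  by rewrite addr0.
- rewrite actM (osc_actF (@mpolyC N K) aplusC aminusC aminus_aplus).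
  set g := act u vac; rewrite -[LHS]/(osc i j g ground + osc _ _ g ground).
  by rewrite !osc_eval0 ?abs_opp // addr0.
rewrite actM (osc_actF (@mpolyC N K) aplusC aminusC aminus_aplus) !osc_vac ?abs_opp //.
by rewrite addr0 linear0.
Qed.

(** The value at [ground] of z applied to [vac] is 0 on n_- U + U n_+, and is p for z = p(F_11, ...,
    F_NN). *)
Lemma at_Fii_inj p : 2%:R != 0 :> K -> @HC_kernel K N (at_Fii p) -> p = 0.
Proof.
move=> char2 /(ker_eval0 char2); rewrite act_at_vac -[LHS]/(p * vac ground).
by rewrite vac_ground mulr1.
Qed.

End Fock.

(** * The Hankel determinant *)

Lemma size_prod_XsubC_cond (R : nzRingType) (I : finType) (P : pred I) (x : I -> R) :
  size (\prod_(i | P i) ('X - (x i)%:P)) = #|P|.+1.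
Proof.
by rewrite -big_filter size_prod_XsubC; have [e _ _ [_ ->]] := big_enumP.
Qed.

Section Lagrange.
Variables (L : fieldType) (I : finType) (P : pred I) (x : I -> L).
Hypothesis x_inj : injective x.

(** Compare leading coefficients in the Lagrange interpolation of f at its |P| nodes. *)
Lemma lagrange_lead (f : {poly L}) : f \is monic -> size f = #|P| ->
  \sum_(m | P m) f.[x m] / \prod_(j | P j && (j != m)) (x m - x j) = 1.
Proof.
move=> f_mon f_size.
pose e m : {poly L} := \prod_(j | P j && (j != m)) ('X - (x j)%:P).
have e_size m : P m -> size (e m) = #|P|.
  move=> Pm; rewrite size_prod_XsubC_cond (cardD1 m P) unfold_in Pm add1n.
  by congr _.+1; apply: eq_card => j; rewrite !inE andbC.
have e_at m : (e m).[x m] = \prod_(j | P j && (j != m)) (x m - x j).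
  by rewrite horner_prod; apply: eq_bigr => j _; rewrite hornerXsubC.
have e_neq0 m : (e m).[x m] != 0.
  rewrite e_at; apply/prodf_neq0 => j /andP[_ jm].
  by rewrite subr_eq0 (inj_eq x_inj) eq_sym.
pose c m := f.[x m] / (e m).[x m].
have fE : f = \sum_(m | P m) c m *: e m.
  apply/eqP; rewrite -subr_eq0; apply/eqP.
  apply: (@roots_geq_poly_eq0 _ _ [seq x m | m <- enum P]).
  - apply/allP => z /mapP[m]; rewrite mem_enum => Pm ->.
    rewrite /root hornerD hornerN horner_sum (bigD1 m) //= hornerZ divfK //.
    rewrite big1 ?addr0 ?subrr // => k /andP[_ km]; rewrite hornerZ.
    rewrite horner_prod (bigD1 m) /=; last by rewrite eq_sym km andbT; exact: Pm.
    by rewrite hornerXsubC subrr mul0r mulr0.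
  - by rewrite map_inj_uniq ?enum_uniq.
  rewrite size_map -cardE; apply: leq_trans (size_polyD _ _) _.
  rewrite geq_max f_size leqnn size_polyN; apply: leq_trans (size_sum _ _ _) _.
  apply/bigmax_leqP => m Pm; apply: leq_trans (size_scale_leq _ _) _.
  by rewrite e_size.
have lead1 : (\sum_(m | P m) c m *: e m)`_(#|P|.-1) = 1.
  by rewrite -fE -f_size -lead_coefE (monicP f_mon).
rewrite -[RHS]lead1 coef_sum.
apply: eq_bigr => m Pm; rewrite coefZ -e_at.
have /monicP : e m \is monic by apply: monic_prod_XsubC.
by rewrite lead_coefE e_size // => ->; rewrite mulr1.
Qed.

End Lagrange.

Lemma det_moments (R : comPzRingType) n (w x : 'I_n -> R) :
  \det (\matrix_(i < n, j < n) \sum_m w m * x m ^+ (i + j))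
  = (\prod_m w m) * (\prod_(i < n) \prod_(j < n | (i < j)%N) (x j - x i)) ^+ 2.
Proof.
pose V : 'M_n := Vandermonde n (\row_m x m).
rewrite (_ : \matrix_(i, j) _ = V *m diag_mx (\row_m w m) *m V^T).
  rewrite !det_mulmx det_tr det_diag det_Vandermonde mulrAC -expr2 mulrC.
  congr (_ * _ ^+ 2); first by apply: eq_bigr => i _; rewrite mxE.
  by apply: eq_bigr => i _; apply: eq_bigr => j _; rewrite !mxE.
apply/matrixP => i j; rewrite !mxE; apply: eq_bigr => m _.
by rewrite mul_mx_diag !mxE exprD mulrCA mulrA.
Qed.

Lemma prod_pairs_neq (R : comPzRingType) n (x : 'I_n -> R) :
  \prod_(i < n) \prod_(j < n | j != i) (x i - x j)
  = (-1) ^+ 'C(n, 2) * (\prod_(i < n) \prod_(j < n | (i < j)%N) (x j - x i)) ^+ 2.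
Proof.
have split_neq i : \prod_(j < n | j != i) (x i - x j) =
    (\prod_(j < n | (i < j)%N) (- (x j - x i))) * \prod_(j < n | (j < i)%N) (x i - x j).
  rewrite (bigID (fun j : 'I_n => (i < j)%N)) /=; congr (_ * _).
    apply: eq_big => [j|j _]; last by rewrite opprB.
    by rewrite -(inj_eq val_inj) neq_ltn; case: ltngtP.
  by apply: eq_bigl => j; rewrite -(inj_eq val_inj) neq_ltn; case: ltngtP.
rewrite (eq_bigr _ (fun i _ => split_neq i)) big_split /=.
under eq_bigr => i _ do rewrite prodrN.
rewrite big_split /= prodrXr -mulrA; congr (_ ^+ _ * _).
  rewrite -bin2_sum big_mkord; under eq_bigr => i _ do rewrite -sum1_card big_mkcond.
  rewrite exchange_big; apply: eq_bigr => j _; rewrite -big_mkcond /=.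
  rewrite -(big_ord_widen _ (fun=> 1%N) (ltnW (ltn_ord j))).
  by rewrite sum1_card card_ord.
rewrite expr2; congr (_ * _).
by rewrite (exchange_big_dep xpredT).
Qed.

(** * Closed form of the eigenvalue recursion and of its moments *)

Section Moments.
Variables (L : fieldType) (N : nat) (lam x : 'I_N -> L).
Hypothesis x_inj : injective x.
Let y j := x j + lam j *+ 2.
Implicit Types (i m k : 'I_N).

Let num (a : nat) m := \prod_(j < N | (a <= j)%N) (x m - y j).
Let den (a : nat) m := \prod_(j < N | (a <= j)%N && (j != m)) (x m - x j).
(** The coefficient of x_m^s in the closed form [diag_eigE] of the i-th eigenvalue. *)
Let alpha i m := num i.+1 m / den i m.

Let num_rec i m : num i m = (x m - y i) * num i.+1 m.
Proof.
rewrite /num (bigD1 i) //=; congr (_ * _); apply: eq_bigl => j.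
by rewrite ltn_neqAle andbC eq_sym -(inj_eq val_inj).
Qed.

Let den_rec i m : i != m -> den i m = (x m - x i) * den i.+1 m.
Proof.
move=> im; rewrite /den (bigD1 i) ?leqnn //=; congr (_ * _); apply: eq_bigl => j.
by rewrite andbAC ltn_neqAle [_ && (i <= j)%N]andbC eq_sym -(inj_eq val_inj).
Qed.

Let den_diag m : den m m = den m.+1 m.
Proof.
apply: eq_bigl => j; rewrite ltn_neqAle -(inj_eq val_inj) /=.
by case: ltngtP.
Qed.

Let den_neq0 a m : den a m != 0.
Proof.
by apply/prodf_neq0 => j /andP[_ jm]; rewrite subr_eq0 (inj_eq x_inj) eq_sym.
Qed.

Let x_sub i m : i != m -> x m - x i != 0.
Proof. by move=> im; rewrite subr_eq0 (inj_eq x_inj) eq_sym. Qed.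

Let alpha_rec i m : i != m -> alpha i m * (x m - x i) = num i.+1 m / den i.+1 m.
Proof.
move=> im; rewrite /alpha den_rec // invfM mulrA mulrAC mulfVK //.
exact: x_sub.
Qed.

(** A telescoping sum, by descending induction on a: since y_a = x_a + 2 lam_a, adding the term k =
    a turns -(x_m - x_a) into -(x_m - y_a). *)
Lemma tail_weight d (a : nat) m : (a + d = m)%N ->
  (\sum_(k < N | (a <= k <= m)%N) lam k * alpha k m) *+ 2 = - num a m / den a m.
Proof.
elim: d a => [|d IH] a adm.
  rewrite addn0 in adm; rewrite adm (bigD1 m) ?leqnn //= big1 => [|k]; last first.
    by rewrite -(inj_eq val_inj) /=; case: ltngtP.
  rewrite addr0 num_rec den_diag /alpha den_diag /y; ring.
have am : (a < m)%N by rewrite -adm addnS ltnS leq_addr.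
pose i := Ordinal (ltn_trans am (ltn_ord m)).
have im : i != m by rewrite -(inj_eq val_inj) /= ltn_eqF.
rewrite (bigD1 i) /= ?leqnn ?(ltnW am) //.
rewrite (eq_bigl (fun k => a < k <= m)%N) => [|k]; last first.
  rewrite -(inj_eq val_inj) /= ltn_neqAle eq_sym.
  by case: eqP; rewrite ?andbF ?andbT.
rewrite mulrnDl IH -?adm ?addSnnS // -[a]/(val i) num_rec.
rewrite /alpha den_rec //= /y; field.
by rewrite den_neq0 x_sub.
Qed.

(** The initial value s = 0: interpolate the product of the X - y_j for j > i at the nodes x_m, m >=
    i. *)
Lemma alpha_sum i : \sum_(m < N | (i <= m)%N) alpha i m = 1.
Proof.
pose f : {poly L} := \prod_(j < N | (i < j)%N) ('X - (y j)%:P).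
have := @lagrange_lead _ _ (fun j : 'I_N => i <= j)%N x x_inj f.
rewrite /f monic_prod_XsubC size_prod_XsubC_cond => <- //; last first.
  rewrite [RHS](cardD1 i) unfold_in leqnn add1n; congr _.+1; apply: eq_card => j.
  by rewrite !inE /= unfold_in ltn_neqAle eq_sym.
apply: eq_bigr => m _; rewrite /alpha; congr (_ / _).
by rewrite horner_prod; apply: eq_bigr => j _; rewrite hornerXsubC.
Qed.

Lemma diag_eigE s i :
  diag_eig lam x s i = \sum_(m < N | (i <= m)%N) alpha i m * x m ^+ s.
Proof.
elim: s i => [|s IH] i /=.
  by rewrite -(alpha_sum i); apply: eq_bigr => m _; rewrite mulr1.
rewrite IH mulr_sumr -sumrMnl.
have -> : \sum_(k < N | (i < k)%N) lam k * diag_eig lam x s k *+ 2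
    = \sum_(m < N | (i <= m)%N)
        (\sum_(k < N | (i < k <= m)%N) lam k * alpha k m) *+ 2 * x m ^+ s.
  under eq_bigr => k _ do rewrite IH mulr_sumr -sumrMnl.
  rewrite (exchange_big_dep (fun m : 'I_N => (i <= m)%N)) /=; last first.
    by move=> k m ik km; apply: ltnW (leq_trans ik km).
  apply: eq_bigr => m im; rewrite mulrnAl mulr_suml -sumrMnl.
  by apply: eq_bigr => k _; rewrite mulrA.
rewrite -sumrB; apply: eq_bigr => m le_im.
have [<-|im] := eqVneq i m.
  rewrite big1 => [|k]; last by case: ltngtP.
  by rewrite mul0rn mul0r subr0 exprS mulrCA.
have lt_im : (i < m)%N by rewrite ltn_neqAle -(inj_eq val_inj) in im *; rewrite im.
(* The inner sum is -alpha_im (x_m - x_i), so the coefficient becomes alpha_im (x_i + x_m - x_i) =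
   alpha_im x_m. *)
rewrite (@tail_weight (m - i.+1)) ?subnKC // mulNr -alpha_rec // exprS; ring.
Qed.

Lemma momentE s : (\sum_k lam k * diag_eig lam x s k) *+ 2
  = \sum_m (- num 0 m / den 0 m) * x m ^+ s.
Proof.
under eq_bigr => k _ do rewrite diag_eigE mulr_sumr.
rewrite (exchange_big_dep xpredT) //= -sumrMnl; apply: eq_bigr => m _.
rewrite -(@tail_weight m) // mulrnAl mulr_suml; congr (_ *+ 2).
by apply: eq_bigr => k _; rewrite mulrA.
Qed.

Lemma det_diag_eig :
  \det (\matrix_(i < N, j < N) ((\sum_k lam k * diag_eig lam x (i + j) k) *+ 2))
  = (-1) ^+ 'C(N, 2) * \prod_m (- \prod_j (x m - y j)).
Proof.
under eq_mx => i j do rewrite momentE.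
rewrite det_moments prodf_div.
(* The denominators of the weights multiply to the squared Vandermonde product up to sign, so they
   cancel it. *)
have denE : \prod_m den 0 m = (-1) ^+ 'C(N, 2)
    * (\prod_(i < N) \prod_(j < N | (i < j)%N) (x j - x i)) ^+ 2.
  exact: prod_pairs_neq.
have : \prod_m den 0 m != 0 by apply/prodf_neq0 => m _.
rewrite denE; set s := (-1) ^+ _; set V := _ ^+ 2.
rewrite mulf_eq0 negb_or => /andP[s0 V0].
by rewrite invfM [_ * (_ / V)]mulrA divfK // mulrC /s -exprVn invrN1.
Qed.

End Moments.

(** * The resultant and the theorem *)

(** The list chosen by [split_roots] is a permutation of r by unique factorisation. *)
Lemma Res_split (L : fieldType) (c : L) (r : seq L) (g : {poly L}) : c != 0 ->
  Res (c *: \prod_(a <- r) ('X - a%:P)) g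
  = c ^+ (size g).-1 * \prod_(a <- r) g.[a].
Proof.
move=> c0; set f := c *: _.
have f_lead : lead_coef f = c.
  by rewrite lead_coefZ (monicP (monic_prod_XsubC _ _ _)) mulr1.
rewrite /Res f_lead /split_roots; congr (_ * _).
case: pselect => [h|[]]; last by exists r; rewrite f_lead.
case: (cid h) => s /= fs; apply: perm_big; apply: prod_XsubC_eq.
by apply: (scalerI c0); rewrite -[in RHS]/f fs f_lead.
Qed.

Section Assembly.
Variables (K : fieldType) (N : nat).
Hypothesis char2 : 2%:R != 0 :> K.
Local Notation B := {mpoly K[N]}.
Local Notation L := {fraction B}.
Implicit Types (i j m : 'I_N).

Lemma HC_eq (z : U (qN K N)) p : HC_kernel (z - at_Fii p) -> HC z = p.
Proof.
move=> zp; rewrite /HC; case: pselect => [h|[]]; last by exists p.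
case: (cid h) => q /= zq; apply/eqP; rewrite -subr_eq0; apply/eqP.
apply: (at_Fii_inj char2); rewrite at_B -(subrKA z) -[at_Fii q - z]opprB addrC.
exact: kerB.
Qed.

Lemma meval_neq0 (v : 'I_N -> K) (p : B) : p.@[v] != 0 -> p != 0.
Proof. by apply: contra_neq => ->; rewrite meval0. Qed.

Lemma mX_neq0 i : 'X_i != 0 :> B.
Proof. by apply: (@meval_neq0 (fun=> 1)); rewrite mevalXU oner_eq0. Qed.

Lemma mXD_neq0 i j : 'X_i + 'X_j != 0 :> B.
Proof.
have [<-|ij] := eqVneq i j.
  (* The value at (1, ..., 1) is 2, nonzero by [char2]. *)
  by apply: (@meval_neq0 (fun=> 1)); rewrite mevalD mevalXU.
apply: (@meval_neq0 (fun k => (k == i)%:R)).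
by rewrite mevalD !mevalXU eqxx [j == i]eq_sym (negPf ij) addr0 oner_eq0.
Qed.

Lemma mXB_neq0 i j : i != j -> 'X_i - 'X_j != 0 :> B.
Proof.
move=> ij; apply: (@meval_neq0 (fun k => (k == i)%:R)).
by rewrite mevalB !mevalXU eqxx [j == i]eq_sym (negPf ij) subr0 oner_eq0.
Qed.

Lemma mXB1_neq0 i j : 'X_i - 'X_j - 1 != 0 :> B.
Proof.
apply: (@meval_neq0 (fun=> 0)).
by rewrite !mevalB !mevalXU meval1 subrr sub0r oppr_eq0 oner_eq0.
Qed.

Lemma xlam_neq0 i : xlam K i != 0.
Proof.
apply: mulf_neq0; first exact: mX_neq0.
apply: (@meval_neq0 (fun=> 0)).
by rewrite mevalB mevalXU meval1 sub0r oppr_eq0 oner_eq0.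
Qed.

Lemma ylam_neq0 i : ylam K i != 0.
Proof.
apply: mulf_neq0; first exact: mX_neq0.
apply: (@meval_neq0 (fun=> 0)).
by rewrite mevalD mevalXU meval1 add0r oner_eq0.
Qed.

Lemma xlam_inj : injective (@xlam K N).
Proof.
move=> i j; apply: contra_eq => ij.
have -> : (xlam K i != xlam K j) = (('X_i - 'X_j) * ('X_i + 'X_j - 1) != 0 :> B).
  by rewrite -subr_eq0 /xlam; congr (_ != _); ring.
apply: mulf_neq0; first exact: mXB_neq0.
apply: (@meval_neq0 (fun=> 0)).
by rewrite mevalB mevalD !mevalXU meval1 !add0r oppr_eq0 oner_eq0.
Qed.

Lemma xlam_sub_ylam i j : xlam K i - ylam K j = ('X_i + 'X_j) * ('X_i - 'X_j - 1).
Proof. by rewrite /xlam /ylam; ring. Qed.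

(** The diagonal factor lam_i - lam_i - 1 = -1 absorbs the minus sign in front of each product. *)
Lemma prod_xlam_sub_ylam :
  \prod_i (- \prod_j (xlam K i - ylam K j))
  = \prod_(i < N) \prod_(j < N) ('X_i + 'X_j)
      * \prod_(i < N) \prod_(j < N | i != j) ('X_i - 'X_j - 1).
Proof.
rewrite -big_split; apply: eq_bigr => i _ /=.
under eq_bigr => j _ do rewrite xlam_sub_ylam.
rewrite big_split (bigD1 i (F := fun j => 'X_i - 'X_j - 1)) //= subrr sub0r.
rewrite mulN1r mulrN opprK; congr (_ * _).
by apply: eq_bigl => j; rewrite eq_sym.
Qed.

Lemma det_odd_cyclic :
  \det (\matrix_(i < N, j < N)
    ((\sum_k 'X_k * diag_eig (fun l => 'X_l) (@xlam K N) (i + j) k) *+ 2))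
  = (-1) ^+ 'C(N, 2) * \prod_i (- \prod_j (xlam K i - ylam K j)).
Proof.
(* The partial fractions need a field, so the identity is checked in the fraction field. *)
apply/eqP; rewrite -tofrac_eq -det_map_mx; apply/eqP.
pose lam i : L := tofrac 'X_i; pose x i : L := tofrac (xlam K i).
have x_inj : injective x.
  by move=> i j /eqP; rewrite tofrac_eq => /eqP /xlam_inj.
have -> : map_mx (@tofrac B) (\matrix_(i < N, j < N)
    ((\sum_k 'X_k * diag_eig (fun l => 'X_l) (@xlam K N) (i + j) k) *+ 2))
  = \matrix_(i < N, j < N) ((\sum_k lam k * diag_eig lam x (i + j) k) *+ 2).
  apply/matrixP => i j; rewrite !mxE rmorphMn rmorph_sum; congr (_ *+ 2).
  by apply: eq_bigr => k _; rewrite rmorphM rmorph_diag_eig.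
rewrite det_diag_eig // rmorphM rmorph_sign rmorph_prod; congr (_ * _).
apply: eq_bigr => i _; rewrite rmorphN rmorph_prod; congr (- _).
apply: eq_bigr => j _; rewrite rmorphB; congr (_ - _).
by rewrite /x /lam -rmorphMn -rmorphD /xlam /ylam; congr (tofrac _); ring.
Qed.

(** Q has roots 1/x_i and leading coefficient the product of the -x_i, and (-x_i)^N P(1/x_i) =
    (-1)^N times the product over j of x_i - y_j. The N signs (-1)^N amount to (-1)^N, as N^2 and N
    have the same parity. *)
Lemma Res_Q_P : Res (Q_poly K N) (P_poly K N)
  = tofrac (\prod_i (- \prod_j (xlam K i - ylam K j))).
Proof.
pose x i : L := tofrac (xlam K i); pose y i : L := tofrac (ylam K i).
have x0 i : x i != 0 by rewrite tofrac_eq0 xlam_neq0.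
have y0 i : y i != 0 by rewrite tofrac_eq0 ylam_neq0.
have lin (a : L) : a != 0 -> 1 - a *: 'X = (- a) *: ('X - (a^-1)%:P) :> {poly L}.
  move=> a0; rewrite scalerBr !scaleNr opprK [RHS]addrC; congr (_ - _).
  by rewrite -mul_polyC -polyCM mulfV.
have -> : Q_poly K N = (\prod_i - x i)
    *: \prod_(a <- [seq (x i)^-1 | i <- enum 'I_N]) ('X - a%:P).
  rewrite big_map big_enum -scaler_prod; apply: eq_bigr => i _.
  exact: lin (x0 i).
rewrite Res_split; last by apply/prodf_neq0 => i _; rewrite oppr_eq0.
have -> : size (P_poly K N) = N.+1.
  rewrite /P_poly (eq_bigr _ (fun j _ => lin _ (y0 j))) scaler_prod.
  rewrite size_scale; last by apply/prodf_neq0 => i _; rewrite oppr_eq0 y0.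
  by rewrite size_prod_XsubC_cond card_ord.
rewrite big_map big_enum [in RHS]prodrN rmorphM rmorph_sign rmorph_prod card_ord.
have -> : (-1) ^+ N = \prod_(i < N) (-1) ^+ N :> L.
  by rewrite prodr_const card_ord -exprM -[RHS]signr_odd oddM andbb signr_odd.
rewrite -prodrXl -!big_split; apply: eq_bigr => i _ /=.
rewrite (exprNn (x i)) -mulrA; congr (_ * _); rewrite /P_poly horner_prod rmorph_prod.
rewrite -[X in _ ^+ X]card_ord -prodr_const -big_split; apply: eq_bigr => j _ /=.
rewrite !hornerE mulrBr mulr1 mulrCA mulfV // mulr1.
by rewrite rmorphB.
Qed.

Lemma Delta_central_HC_neq0 :
  [/\ supercentral (Delta K N),
      tofrac (HC (Delta K N)) =
        (-1) ^+ 'C(N, 2) * Res (Q_poly K N) (P_poly K N),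
      HC (Delta K N) =
        (-1) ^+ 'C(N, 2)
          * \prod_(i < N) \prod_(j < N) ('X_i + 'X_j)
          * \prod_(i < N) \prod_(j < N | i != j) ('X_i - 'X_j - 1)
    & Delta K N <> 0].
Proof.
have kD := ker_Delta N char2; rewrite det_odd_cyclic in kD.
have HCD := HC_eq kD.
split.
- exact: supercentral_even (U_homog_Delta K N) (Delta_comm char2).
- by rewrite HCD Res_Q_P rmorphM rmorph_sign.
- by rewrite HCD prod_xlam_sub_ylam mulrA.
(* If Delta were 0, its explicit image would lie in the kernel and vanish by [at_Fii_inj], yet all
   its factors are nonzero. *)
move=> D0; move: kD; rewrite D0 sub0r => /(kerN).
rewrite opprK => /(at_Fii_inj char2)/eqP; apply/negP.
rewrite mulf_neq0 ?signr_eq0 //; apply/prodf_neq0 => i _.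
rewrite oppr_eq0; apply/prodf_neq0 => j _; rewrite xlam_sub_ylam.
by rewrite mulf_neq0 ?mXD_neq0 ?mXB1_neq0.
Qed.

End Assembly.

Theorem theorem5p8 (R : realType) (N : nat) (hN : (0 < N)%N) :
  [/\ supercentral (Delta R[i] N),
      tofrac (HC (Delta R[i] N)) =
        (-1) ^+ 'C(N, 2) * Res (Q_poly R[i] N) (P_poly R[i] N),
      HC (Delta R[i] N) =
        (-1) ^+ 'C(N, 2)
          * \prod_(i < N) \prod_(j < N) ('X_i + 'X_j)
          * \prod_(i < N) \prod_(j < N | i != j) ('X_i - 'X_j - 1)
    & Delta R[i] N <> 0].
Proof. by apply: Delta_central_HC_neq0; rewrite Num.Theory.pnatr_eq0. Qed.
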